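(* For each real $\alpha>-1$ and every $R\in\mathcal{U}_R$ that has at least one critical point on the unit circle $\mathbb{T}$, we have $\mathbb{M}_R(\alpha)\geq \mathbb{M}_{\kappa}(\alpha)$.
   Context: $\Delta=\{z\in\mathbb{C}:|z|<1\}$ and $\mathbb{T}=\{z\in\mathbb{C}:|z|=1\}$. $\mathcal{A}(\Delta)$ is the set of analytic functions on $\Delta$. For $\alpha>-1$, the weighted Bergman space is ${\bf A}_{\alpha}^2=\{\phi\in\mathcal{A}(\Delta): \|\phi\|_{\alpha}^2:=(\alpha+1)\iint_{\Delta}|\phi(z)|^2(1-|z|^2)^{\alpha}\frac{dx\,dy}{\pi}<\infty\}$. For $\beta>\alpha>-1$, a function $g\in\mathcal{A}(\Delta)$ is a multiplier from ${\bf A}_\alpha^2$ to ${\bf A}_\beta^2$ if $\phi\mapsto g\phi$ is bounded from ${\bf A}_\alpha^2$ to ${\bf A}_\beta^2$; its multiplier norm is $\|g\|_{{\bf M}_{\alpha,\beta}}:=\sup_{\phi\in{\bf A}_\alpha^2,\,\phi\neq0}\|g\phi\|_\beta/\|\phi\|_\alpha$. $\mathcal{S}$ is the class of univalent (injective analytic) functions $f$ in $\Delta$ with $f(0)=0$, $f'(0)=1$. The Schwarzian derivative of a locally univalent function $f$ is $S(f)=\left(\frac{f''}{f'}\right)'-\frac12\left(\frac{f''}{f'}\right)^2$. It is known that $|S(f)(z)|(1-|z|^2)^2\le 6$ on $\Delta$ for $f\in\mathcal{S}$, so $S(f)$ is a multiplier from ${\bf A}_\alpha^2$ to ${\bf A}_{\alpha+4}^2$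 for every $\alpha>-1$. Put $\mathbb{M}_f(\alpha):=\|S(f)\|_{{\bf M}_{\alpha,\alpha+4}}$ for $f\in\mathcal{S}$. $\kappa(z)=\frac{z}{(1-z)^2}$ is the Koebe function. $\mathcal{U}_R$ is the class of all rational functions that (restricted to $\Delta$) belong to $\mathcal{S}$. A critical point of $R$ on $\mathbb{T}$ is a point $z_0\in\mathbb{T}$ at which $R$ is analytic and $R'(z_0)=0$. *)

(* Defs.v *)
From HB Require Import structures.
From mathcomp Require Import all_boot all_order all_algebra complex.
From mathcomp Require Import all_classical all_reals all_analysis.

Set Implicit Arguments.
Unset Strict Implicit.
Unset Printing Implicit Defensive.

Import Order.TTheory GRing.Theory Num.Theory.
Import numFieldNormedType.Exports.

Local Open Scope classical_set_scope.
Local Open Scope ring_scope.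
Local Open Scope complex_scope.

(* R[i] is given its usual topology, as a normed module over itself: [derivable]
   and [derive1] then denote complex differentiability and the complex
   derivative. *)
HB.instance Definition _ (R : realType) := NormedModule.copy R[i] R[i]^o.

Section Definitions.
Variable R : realType.
Local Notation C := R[i].

Definition unit_disk : set C := [set z | `|z| < 1].

Definition unit_circle : set C := [set z | `|z| = 1].

Definition analytic_on (D : set C) (f : C -> C) : Prop :=
  forall z, D z -> derivable f z 1.

Definition analytic_at (f : C -> C) (z : C) : Prop :=
  \forall w \near z, derivable f w 1.

(* The modulus [`|z|] of MathComp is an element of R[i]; here it is taken in R. *)
Definition modulus (z : C) : R := ComplexField.Normc.normc z.

(* Functions on the disk are represented by total functions on R[i], whose values
   outside the disk are never used. The integral of a nonnegative function
   always exists in [\bar R]. *)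
Definition bergman_normsq (alpha : R) (phi : C -> C) : \bar R :=
  ((alpha + 1)%:E *
   \int[(@lebesgue_measure R \x @lebesgue_measure R)%E]_(p in
          [set p : R * R | unit_disk (p.1 +i* p.2)])
     (modulus (phi (p.1 +i* p.2)) ^+ 2 *
      (1 - modulus (p.1 +i* p.2) ^+ 2) `^ alpha / pi)%:E)%E.

Definition bergman_norm (alpha : R) (phi : C -> C) : \bar R :=
  sqrte (bergman_normsq alpha phi).

Definition bergman_space (alpha : R) : set (C -> C) :=
  [set phi | analytic_on unit_disk phi /\ (bergman_normsq alpha phi < +oo)%E].

(* The supremum is taken in [\bar R], so that it is [+oo] when [g] is not a
   multiplier. [phi] being nonzero means that it is not identically zero on the
   disk; the denominators are then positive and finite. *)
Definition multiplier_norm (alpha beta : R) (g : C -> C) : \bar R :=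
  ereal_sup [set (bergman_norm beta (fun z => (g z * phi z)%R) /
                  bergman_norm alpha phi)%E |
             phi in [set phi | bergman_space alpha phi /\
                               exists2 z, unit_disk z & phi z != 0]].

Definition schwarzian (f : C -> C) : C -> C :=
  let f' := derive1 f in
  let f'' := derive1 f' in
  fun z => derive1 (fun w => f'' w / f' w) z - 2^-1 * (f'' z / f' z) ^+ 2.

Definition schwarzian_multiplier_norm (f : C -> C) (alpha : R) : \bar R :=
  multiplier_norm alpha (alpha + 4) (schwarzian f).

Definition class_S : set (C -> C) :=
  [set f | [/\ analytic_on unit_disk f,
               {in unit_disk &, injective f},
               f 0 = 0
             & derive1 f 0 = 1]].

Definition koebe : C -> C := fun z => z / (1 - z) ^+ 2.

(* The fraction is in lowest terms, and its value at a pole is 0 by the convention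
   [0^-1 = 0]. Such a function is discontinuous at its poles, so that it is
   analytic in the sense above exactly where the rational function is. *)
Definition rational_function (f : C -> C) : Prop :=
  exists p q : {poly C}, [/\ q != 0, coprimep p q &
    forall z, f z = p.[z] / q.[z]].

Definition class_UR : set (C -> C) :=
  [set f | rational_function f /\ class_S f].

Definition critical_point (f : C -> C) (z : C) : Prop :=
  analytic_at f z /\ derive1 f z = 0.

End Definitions.

(* Main.v *)
Require Import Defs.
From HB Require Import structures.
From mathcomp Require Import all_boot all_order all_algebra complex.
From mathcomp Require Import all_classical all_reals all_analysis.
From mathcomp Require Import measurable_realfun simple_functions measurable_fun_approximation.
From mathcomp Require Import ring lra.

(** Near a critical point [z0] on the circle, a zero of order [m] of [f'],
    the Schwarzian is [- (m + m ^+ 2 / 2) / (z - z0) ^+ 2] up to lower order,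
    and [m + m ^+ 2 / 2 >= 3 / 2]. Let [sigma a w = (w + a) / (1 + a * w)]. The
    multiplier norm is invariant under [g |-> (g \o rho) * rho' ^+ 2] for every
    automorphism [rho] of the disk, as [phi |-> (phi \o rho) * rho' `^ ((alpha + 2) / 2)]
    is an isometry of the Bergman space. Apply this to [rho = z0 * sigma a] and
    let [a] tend to 1: the transported Schwarzians converge pointwise to a
    multiple, of modulus at least 1, of [- 6 / (1 - w ^+ 2) ^+ 2], which is the
    Schwarzian of the Koebe function. Fatou's lemma concludes. *)

Set Implicit Arguments.
Unset Strict Implicit.
Unset Printing Implicit Defensive.

Import Order.TTheory GRing.Theory Num.Theory.
Import numFieldNormedType.Exports.

Local Open Scope classical_set_scope.
Local Open Scope ring_scope.
Local Open Scope complex_scope.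

Local Notation Re := complex.Re.
Local Notation Im := complex.Im.

(** * Change of variables on the line *)

(** Bergman norms see only the modulus of a multiplier, so it is enough to bound the Schwarzian from
    below, pointwise, by a double pole at the critical point; no remainder estimate enters. The
    constants then match exactly. A simple zero of [f'] gives [3 / 2], the factor
    [(rho' / (rho - z0)) ^+ 2] tends to [4 / (1 - w ^+ 2) ^+ 2], and [4 * (3 / 2) = 6]; a zero of
    higher order only increases the bound. The isometry rests on the area formula for a disk
    automorphism. Up to translations and scalings such a map is an inversion, and inversions and
    rotations are factored here into maps that change one coordinate at a time. Tonelli's theorem
    then reduces everything to the line, where a substitution is checked on half-open intervals. The
    exponent [(alpha + 2) / 2] is an arbitrary positive real, so the isometry also needs holomorphic
    powers. A logarithm on the right half-plane is enough for them, because [1 - a * z] stays there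
    when [z] is in the disk. *)

Section image_of_density.
Local Open Scope ereal_scope.
Context d d' (T : measurableType d) (T' : measurableType d') (R : realType).
Variables (mu : {measure set T -> \bar R}) (phi : T -> T') (w : T -> R).
Hypotheses (mphi : measurable_fun [set: T] phi).
Hypotheses (mw : measurable_fun [set: T] w) (w0 : forall x, (0 <= w x)%R).

(** The image under [phi] of the measure with density [w]. The three proofs are arguments so that
    the measure structure declared on this term can rely on them. *)
Definition density_image of measurable_fun [set: T] phi &
    measurable_fun [set: T] w & (forall x, (0 <= w x)%R) :=
  fun X : set T' => \int[mu]_(x in phi @^-1` X) (w x)%:E.

Local Notation nu := (density_image mphi mw w0).

Let nu0 : nu set0 = 0.
Proof. by rewrite /density_image preimage_set0 integral_set0. Qed.

Let nu_ge0 X : 0 <= nu X.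
Proof. by apply: integral_ge0 => x _; rewrite lee_fin. Qed.

Let preim_measurable X : measurable X -> measurable (phi @^-1` X).
Proof. by move=> mX; rewrite -[X in measurable X]setTI; exact: mphi. Qed.

Let nu_sigma_additive : semi_sigma_additive nu.
Proof.
move=> /= F mF tF mUF; rewrite /density_image preimage_bigcup.
rewrite ge0_integral_bigcup//=.
- apply: is_cvg_ereal_nneg_natsum_cond => n _ _; exact: nu_ge0.
- by move=> k; exact: preim_measurable.
- apply/measurable_funTS/measurable_EFinP; exact: mw.
- by move=> x _; rewrite lee_fin.
- apply/trivIsetP => i j _ _ ij; rewrite -preimage_setI.
  by move/trivIsetP : tF => ->//; rewrite preimage_set0.
Qed.

HB.instance Definition _ := isMeasure.Build _ _ _
  nu nu0 nu_ge0 nu_sigma_additive.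

Import HBNNSimple.

(** Both sides commute with increasing limits and finite sums of nonnegative functions, and on
    indicators they agree by definition of [density_image]. *)
Lemma ge0_integral_density_image (f : T' -> \bar R) :
    measurable_fun [set: T'] f -> (forall y, 0 <= f y) ->
  \int[nu]_y f y = \int[mu]_x (f (phi x) * (w x)%:E).
Proof.
move=> mf f0; pose h := nnsfun_approx measurableT mf.
have hn_ge0 n y : 0 <= (h n y)%:E by rewrite lee_fin.
have hf y : (h n y)%:E @[n --> \oo] --> f y by exact: cvg_nnsfun_approx.
have ndh y a b : (a <= b)%N -> (h a y)%:E <= (h b y)%:E.
  by move=> ab; rewrite lee_fin; exact/lefP/nd_nnsfun_approx.
have mh n : measurable_fun setT (fun y => (h n y)%:E) by exact/measurable_EFinP.
transitivity (limn (fun n => \int[nu]_y (h n y)%:E)).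
  rewrite -monotone_convergence//; last by move=> x _ a b; exact: ndh.
  by apply: eq_integral => y _; apply/esym/cvg_lim.
transitivity (limn (fun n => \int[mu]_x ((h n (phi x))%:E * (w x)%:E))); last first.
  rewrite -monotone_convergence//.
  - apply: eq_integral => x _; apply/cvg_lim => //.
    exact: cvgeZr.
  - move=> n; apply: emeasurable_funM; last exact/measurable_EFinP.
    exact: (measurableT_comp (mh n) mphi).
  - by move=> n x _; rewrite mule_ge0 ?lee_fin.
  - by move=> x _ a b ab; rewrite lee_wpmul2r ?lee_fin// -lee_fin; exact: ndh.
apply: congr_lim; apply/funext => n.
have mI r : measurable_fun setT
    (fun x => (\1_(h n @^-1` [set r]) (phi x))%:E : \bar R).
  apply: (measurableT_comp (f := fun y => (\1_(h n @^-1` [set r]) y)%:E)) => //.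
  exact/measurable_EFinP.
under [LHS]eq_integral do rewrite fimfunE -fsumEFin//.
rewrite ge0_integral_fsum//; last 2 first.
  - by move=> r; apply/measurable_EFinP/measurable_funM.
  - by move=> r x _; rewrite nnfun_muleindic_ge0.
have hw x : (h n (phi x))%:E * (w x)%:E = \sum_(r \in range (h n))
    ((r * \1_(h n @^-1` [set r]) (phi x))%:E * (w x)%:E).
  rewrite fimfunE -fsumEFin// ge0_mule_fsuml// => r.
  exact: nnfun_muleindic_ge0.
under [RHS]eq_integral do rewrite hw.
rewrite ge0_integral_fsum//; last 2 first.
  - move=> r; apply: emeasurable_funM => //; last exact/measurable_EFinP.
    by under eq_fun do rewrite EFinM; apply: emeasurable_funM.
  - by move=> r x _; rewrite mule_ge0 ?lee_fin// -lee_fin EFinM nnfun_muleindic_ge0.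
apply: eq_fsbigr => r _.
(* A nonnegative simple function has an empty fibre over [r < 0], so both terms vanish. *)
have [r0|r0] := leP 0%R r; last first.
  rewrite !integral0_eq// => x _.
    by rewrite preimage_nnfun0// indic0 mulr0 mul0e.
  by rewrite preimage_nnfun0// indic0 mulr0.
under [LHS]eq_integral do rewrite EFinM.
rewrite ge0_integralZl//; last exact/measurable_EFinP.
rewrite integral_indic//= setIT.
under [RHS]eq_integral do rewrite EFinM -muleA.
rewrite ge0_integralZl//; [|by apply: emeasurable_funM => //; exact/measurable_EFinP|].
  congr (_ * _); rewrite /density_image integral_mkcond.
  apply: eq_integral => x _; rewrite /patch indicE.
  have -> : (x \in phi @^-1` (h n @^-1` [set r])) = (phi x \in h n @^-1` [set r]).
    by apply/idP/idP; rewrite !inE.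
  by case: ifPn; rewrite ?mul1e ?mul0e.
by move=> x _; rewrite mule_ge0 ?lee_fin.
Qed.

End image_of_density.

(* [x^-1 = x * (x ^+ 2) `^ (-1)] also holds at the junk value [x = 0]. *)
Lemma measurable_invr {R : realType} : measurable_fun [set: R] (@GRing.inv R).
Proof.
rewrite (_ : GRing.inv = (fun x : R => x * (x ^+ 2) `^ (-1))).
  apply: measurable_funM => //.
  apply: (measurableT_comp (measurable_powR _)); exact: measurable_funX.
apply/funext => x; rewrite powR_inv1 ?sqr_ge0//.
have [->|x0] := eqVneq x 0; first by rewrite invr0 mul0r.
by rewrite expr2 invfM mulrA divff// mul1r.
Qed.

Section lebesgue_substitution.
Local Open Scope ereal_scope.
Context {R : realType}.
Local Notation mu := (@lebesgue_measure R).
Implicit Types f : R -> \bar R.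

(** Lebesgue measure is determined by its values on half-open intervals, so the hypothesis
    identifies it with the image of the density [w] under [phi]. *)
Lemma ge0_integral_lebesgue_image (phi w : R -> R) :
    measurable_fun [set: R] phi -> measurable_fun [set: R] w ->
    (forall x, (0 <= w x)%R) ->
    (forall a b, (a < b)%R ->
      \int[mu]_(x in phi @^-1` `]a, b]) (w x)%:E = (b - a)%:E) ->
  forall f, measurable_fun [set: R] f -> (forall y, 0 <= f y) ->
  \int[mu]_x (f (phi x) * (w x)%:E) = \int[mu]_y f y.
Proof.
move=> mphi mw w0 ab f mf f0.
rewrite -(@ge0_integral_density_image _ _ (measurableTypeR R) (measurableTypeR R) _ mu phi w mphi mw w0)//.
apply: eq_measure_integral => A mA _.
apply: esym; apply: lebesgue_measure_unique => // _ [[a b]] _ <-.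
rewrite /= lebesgue_measure_itv/= /density_image lte_fin.
case: ifPn => [lab|]; first by rewrite ab// EFinB.
by rewrite -leNgt => ba; rewrite set_itv_ge -?leNgt ?bnd_simp// preimage_set0 integral_set0.
Qed.

Lemma ge0_integral_affine f (c e : R) : (c != 0)%R ->
    measurable_fun [set: R] f -> (forall y, 0 <= f y) ->
  \int[mu]_x (f (c * x + e)%R * `|c|%:E) = \int[mu]_y f y.
Proof.
move=> c0 mf f0.
apply: (@ge0_integral_lebesgue_image (fun x => (c * x + e)%R) (fun=> `|c|%R)) => //.
  by apply: measurable_funD => //; exact: measurable_funM.
move=> a b ab.
rewrite integral_cst/=; last first.
  rewrite -[X in measurable X]setTI.
  have : measurable_fun [set: R] (fun x => (c * x + e)%R).
    by apply: measurable_funD => //; exact: measurable_funM.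
  exact.
have cgt0 : (0 < `|c|)%R by rewrite normr_gt0.
suff -> : mu [set x | `]a, b]%classic (c * x + e)%R] = ((b - a) / `|c|)%:E.
  by rewrite -EFinM mulrCA divff ?mulr1// gt_eqF.
(* The closed end of the preimage interval changes side with the sign of [c]. *)
have [cn|cp|/eqP] := ltrgtP c 0%R; last by rewrite (negbTE c0).
- rewrite (_ : [set x | `]a, b]%classic (c * x + e)%R] = `[((b - e) / c)%R, ((a - e) / c)%R[%classic).
    rewrite [LHS](@lebesgue_measure_itv R)/= lte_fin ltr_ndivrMr// divfK ?lt_eqF//.
    rewrite ltrD2r ab -EFinB ltr0_norm//; congr EFin; field.
    by rewrite lt_eqF.
  apply/seteqP; split => x /=; rewrite !in_itv/= ler_ndivrMr// ltr_ndivlMr//;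
    move=> /andP[? ?]; apply/andP; split; lra.
- rewrite (_ : [set x | `]a, b]%classic (c * x + e)%R] = `]((a - e) / c)%R, ((b - e) / c)%R]%classic).
    rewrite [LHS](@lebesgue_measure_itv R)/= lte_fin ltr_pdivrMr// divfK ?gt_eqF//.
    rewrite ltrD2r ab -EFinB gtr0_norm//; congr EFin; field.
    by rewrite gt_eqF.
  apply/seteqP; split => x /=; rewrite !in_itv/= ler_pdivlMr// ltr_pdivrMr//;
    move=> /andP[? ?]; apply/andP; split; lra.
Qed.

Let integral_invsq (c : R) : (0 < c)%R ->
  \int[mu]_(x in `[c, +oo[) (x ^- 2)%:E = (c^-1)%:E.
Proof.
move=> c0.
have d (x : R) : (0 < x)%R -> is_derive x (1%R : R) (fun x => - x^-1)%R (x ^- 2)%R.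
  move=> x0; have x0' : x != 0%R by rewrite gt_eqF.
  apply: is_derive_eq; first by apply: is_deriveN; apply: is_deriveV.
  by rewrite scaleNr opprK scaler1.
rewrite (@ge0_continuous_FTC2y R _ (fun x => - x^-1)%R _ 0%R).
- by rewrite sub0e -EFinN opprK.
- by move=> x _; rewrite invr_ge0 exprn_even_ge0.
- apply: continuous_in_subspaceT => x /set_mem/=; rewrite in_itv/= andbT => cx.
  have x0 : (0 < x)%R by exact: lt_le_trans cx.
  have : {for x, continuous (fun y : R => y ^- 2)%R}; last by [].
  apply: (@continuousV _ _ (fun y : R => y ^+ 2)%R).
    by rewrite expf_neq0 ?gt_eqF.
  exact: exprn_continuous.
- rewrite -oppr0; apply: cvgN; apply/gtr0_cvgV0; last exact: cvg_id.
  exact: nbhs_pinfty_gt.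
- move=> x cx; have [] := d x (lt_trans c0 cx); by [].
- apply: cvg_at_right_filter; apply: cvgN; apply: inv_continuous.
  by rewrite gt_eqF.
- move=> x; rewrite in_itv/= andbT => cx; rewrite derive1E.
  by have [_ ->] := d x (lt_trans c0 cx).
Qed.

Lemma ge0_integral_inv f :
    measurable_fun [set: R] f -> (forall y, 0 <= f y) ->
  \int[mu]_(x in `]0%R, +oo[) (f x^-1%R * (x ^- 2)%:E) =
  \int[mu]_(y in `]0%R, +oo[) f y.
Proof.
move=> mf f0.
(* Extending the inversion by the identity, with weight 1, makes it preserve Lebesgue measure on the
   whole line, as [ge0_integral_lebesgue_image] requires. *)
pose phi (x : R) : R := if (0 < x)%R then x^-1%R else x.
pose w (x : R) : R := if (0 < x)%R then x ^- 2 else 1%R.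
have mpos : measurable_fun [set: R] (fun x : R => (0 < x)%R).
  exact: measurable_fun_ltr.
have mV := @measurable_invr R.
have mphi : measurable_fun [set: R] phi by apply: measurable_fun_ifT.
have mw : measurable_fun [set: R] w.
  apply: measurable_fun_ifT => //.
  under eq_fun do rewrite -exprVn; exact: measurable_funX.
have w0 x : (0 <= w x)%R.
  by rewrite /w; case: ifP => // _; rewrite invr_ge0 exprn_even_ge0.
have key := @ge0_integral_lebesgue_image phi w mphi mw w0.
rewrite integral_mkcond [RHS]integral_mkcond -[RHS]key//.
- apply: eq_integral => x _; rewrite /patch /phi /w !mem_setE !in_itv/= !andbT.
  by case: ifPn => [x0|]; [rewrite invr_gt0 x0|move=> /negbTE ->; rewrite mul0e].
- move=> a b ab.
  have mwT D : measurable_fun D (fun x => (w x)%:E).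
    by apply/measurable_EFinP; exact: measurable_funTS.
  have wE0 x : 0 <= (w x)%:E by rewrite lee_fin.
  have tail c : (0 < c)%R -> \int[mu]_(x in `[c, +oo[) (w x)%:E = (c^-1)%:E.
    move=> c0; rewrite -integral_invsq//; apply: eq_integral => x.
    by rewrite mem_setE in_itv/= andbT /w => /(lt_le_trans c0) ->.
  have body c d : (d <= 0)%R -> (c <= d)%R ->
      \int[mu]_(x in `]c, d]) (w x)%:E = (d - c)%:E.
    move=> d0 cd; rewrite (eq_integral (cst 1)).
      rewrite integral_cst//= mul1e lebesgue_measure_itv/= lte_fin EFinB.
      move: cd; rewrite le_eqVlt => /predU1P[->|->//].
      by rewrite ltxx -EFinB subrr.
    move=> x; rewrite mem_setE in_itv/= /w => /andP[_ xd].
    by rewrite ltNge (le_trans xd d0).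
  have phipos x : (0 < x)%R -> phi x = x^-1%R by rewrite /phi => ->.
  have phineg x : (x <= 0)%R -> phi x = x by rewrite /phi ltNge => ->.
  have pos c x : (0 < c)%R -> (phi x <= c)%R && (0 < x)%R = (c^-1 <= x)%R.
    move=> c0; case: (ltP 0%R x) => x0.
      by rewrite andbT phipos// invf_ple.
    rewrite andbF; apply/esym/negbTE; rewrite -ltNge (le_lt_trans x0)//.
    by rewrite invr_gt0.
  (* The preimage of []a, b]] depends on the position of 0: [phi] is the identity to its left and
     reverses the order to its right. *)
  have [b0|b0] := leP b 0%R.
    rewrite -body ?(ltW ab)//.
    congr (integral mu _ _); apply/seteqP; split => x /=.
      rewrite !in_itv/=; have [x0|x0] := leP x 0%R; first by rewrite phineg.
      rewrite phipos// => /andP[_ xb].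
      by move: (le_trans xb b0); rewrite leNgt invr_gt0 x0.
    rewrite !in_itv/= => /andP[ax xb].
    by rewrite phineg ?ax//; exact: le_trans b0.
  have [a0|a0] := ltP a 0%R.
    transitivity (\int[mu]_(x in `]a, 0%R] `|` `[b^-1%R, +oo[) (w x)%:E).
      congr (integral mu _ _); apply/seteqP; split => x /=; rewrite !in_itv/= andbT.
        have [x0|x0] := leP x 0%R; first by rewrite phineg// => /andP[-> _]; left.
        by rewrite -pos// x0 andbT => /andP[_ ->]; right.
      move=> [/andP[ax x0]|]; first by rewrite phineg// ax (le_trans x0)// ltW.
      rewrite -pos// => /andP[-> x0]; rewrite phipos// andbT.
      by rewrite (lt_trans a0)// invr_gt0.
    rewrite ge0_integral_setU//.
      by rewrite tail ?invr_gt0// invrK body ?(ltW a0)// sub0r -EFinD addrC.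
      exact: mwT.
    apply/disj_setPRL => x /=; rewrite !in_itv/= andbT => bx /andP[_].
    by apply/negP; rewrite -ltNge (lt_le_trans _ bx)// invr_gt0.
  have [a0'|a0'] := eqVneq a 0%R.
    rewrite a0' subr0 -[b in RHS]invrK -tail ?invr_gt0//.
    congr (integral mu _ _); apply/seteqP; split => x /=; rewrite !in_itv/= andbT -pos//.
      have [x0|x0] := leP x 0%R; last by case/andP => _ ->.
      by rewrite phineg// ltNge x0.
    by move=> /andP[-> x0]; rewrite phipos// invr_gt0 x0.
  have {a0 a0'} a0 : (0 < a)%R by rewrite lt_neqAle eq_sym a0'.
  have ba : (b^-1 < a^-1)%R by rewrite ltf_pV2.
  (* Adding the tail beyond [a^-1], of integral [a], completes the preimage to the tail from [b^-1];
     the finite [a] is cancelled afterwards. *)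
  have : \int[mu]_(x in phi @^-1` `]a, b]) (w x)%:E + (a)%:E = b%:E.
    rewrite -[b in RHS]invrK -[a in X in _ + X]invrK -!tail ?invr_gt0//.
    have -> : phi @^-1` `]a, b] = `[b^-1%R, a^-1%R[%classic.
      apply/seteqP; split => x /=; rewrite !in_itv/=.
        move=> /andP[ax xb].
        have x0 : (0 < x)%R.
          by rewrite ltNge; apply/negP => x0; move: ax; rewrite phineg// ltNge (le_trans x0)// ltW.
        by rewrite -pos// xb x0/= -(invrK x) ltf_pV2 ?posrE ?invr_gt0// -phipos.
      move=> /andP[]; rewrite -pos// => /andP[-> x0]; rewrite phipos// andbT => xa.
      by rewrite -(invrK a) ltf_pV2 ?posrE ?invr_gt0.
    rewrite -ge0_integral_setU//.
      congr (integral mu _ _); apply/seteqP; split => x /=; rewrite !in_itv/= ?andbT.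
        by case=> [/andP[]//|]; apply: le_trans; exact: ltW.
      by move=> bx; case: (ltP x a^-1%R) => xa; [left; rewrite bx|right].
      exact: mwT.
    apply/disj_setPRL => x /=; rewrite !in_itv/= andbT => ax /andP[_].
    by rewrite ltNge ax.
  case: (\int[mu]_(x in phi @^-1` `]a, b]) (w x)%:E) => [r| |]//=.
  by rewrite -EFinD => -[<-]; rewrite addrK.
- by apply: (measurable_restrictT f (measurable_itv `]0%R, +oo[)).1; exact: measurable_funTS.
- by move=> y; rewrite /patch; case: ifPn.
Qed.

End lebesgue_substitution.

(** * Change of variables in the plane *)

Section planar_substitution.
Local Open Scope ereal_scope.
Context {R : realType}.
Local Notation mu := (@lebesgue_measure R).
Local Notation mu2 := (mu \x mu).
Implicit Types F G : R * R -> \bar R.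

Lemma eq_integral_fiber1 F G :
    measurable_fun [set: R * R] F -> (forall p, 0 <= F p) ->
    measurable_fun [set: R * R] G -> (forall p, 0 <= G p) ->
    (forall y, \int[mu]_x F (x, y) = \int[mu]_x G (x, y)) ->
  \int[mu2]_p F p = \int[mu2]_p G p.
Proof.
move=> mF F0 mG G0 FG; rewrite fubini_tonelli2// fubini_tonelli2//.
by apply: eq_integral => y _; exact: FG.
Qed.

Lemma eq_integral_fiber2 F G :
    measurable_fun [set: R * R] F -> (forall p, 0 <= F p) ->
    measurable_fun [set: R * R] G -> (forall p, 0 <= G p) ->
    (forall x, \int[mu]_y F (x, y) = \int[mu]_y G (x, y)) ->
  \int[mu2]_p F p = \int[mu2]_p G p.
Proof.
move=> mF F0 mG G0 FG; rewrite fubini_tonelli1// [RHS]fubini_tonelli1//.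
by apply: eq_integral => y _; exact: FG.
Qed.

Lemma measurable_fun_comp_pairM F (u v w : R * R -> R) :
    measurable_fun [set: R * R] F ->
    measurable_fun [set: R * R] u -> measurable_fun [set: R * R] v ->
    measurable_fun [set: R * R] w ->
  measurable_fun [set: R * R] (fun p => F (u p, v p) * (w p)%:E).
Proof.
move=> mF mu_ mv mw; apply: emeasurable_funM; last exact/measurable_EFinP.
apply: (measurableT_comp mF); exact: measurable_fun_pair.
Qed.

(** Slope and shift may depend on the coordinate left fixed, which covers shears as well as
    scalings. On a fibre of slope 0 both integrals vanish. *)
Lemma ge0_integral_affine1 F (c e : R -> R) :
    measurable_fun [set: R * R] F -> (forall p, 0 <= F p) ->
    measurable_fun [set: R] c -> measurable_fun [set: R] e ->
    (forall y, c y = 0%R -> forall x, F (x, y) = 0) ->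
  \int[mu2]_p (F (c p.2 * p.1 + e p.2, p.2)%R * (`|c p.2|)%:E) =
  \int[mu2]_p F p.
Proof.
move=> mF F0 mc me c0.
have mc2 : measurable_fun [set: R * R] (fun p => c p.2) by exact: measurableT_comp.
have me2 : measurable_fun [set: R * R] (fun p => e p.2) by exact: measurableT_comp.
apply: eq_integral_fiber1 => //.
- apply: measurable_fun_comp_pairM => //.
    by apply: measurable_funD => //; exact: measurable_funM.
  exact: measurableT_comp.
- by move=> p; rewrite mule_ge0.
- move=> y /=; have [cy|cy] := eqVneq (c y) 0%R.
    rewrite [RHS]integral0_eq; last by move=> x _; rewrite c0.
    by apply: integral0_eq => x _; rewrite c0// mul0e.
  apply: (ge0_integral_affine (f := fun x => F (x, y))) => //.
  exact: measurableT_comp.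
Qed.

Lemma ge0_integral_affine2 F (c e : R -> R) :
    measurable_fun [set: R * R] F -> (forall p, 0 <= F p) ->
    measurable_fun [set: R] c -> measurable_fun [set: R] e ->
    (forall x, c x = 0%R -> forall y, F (x, y) = 0) ->
  \int[mu2]_p (F (p.1, c p.1 * p.2 + e p.1)%R * (`|c p.1|)%:E) =
  \int[mu2]_p F p.
Proof.
move=> mF F0 mc me c0.
have mc1 : measurable_fun [set: R * R] (fun p => c p.1) by exact: measurableT_comp.
have me1 : measurable_fun [set: R * R] (fun p => e p.1) by exact: measurableT_comp.
apply: eq_integral_fiber2 => //.
- apply: measurable_fun_comp_pairM => //.
    by apply: measurable_funD => //; exact: measurable_funM.
  exact: measurableT_comp.
- by move=> p; rewrite mule_ge0.
- move=> x /=; have [cx|cx] := eqVneq (c x) 0%R.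
    rewrite [RHS]integral0_eq; last by move=> y _; rewrite c0.
    by apply: integral0_eq => y _; rewrite c0// mul0e.
  apply: (ge0_integral_affine (f := fun y => F (x, y))) => //.
  exact: measurableT_comp.
Qed.

Lemma ge0_integral_diag F (c1 c2 e1 e2 : R) :
    c1 != 0%R -> c2 != 0%R ->
    measurable_fun [set: R * R] F -> (forall p, 0 <= F p) ->
  \int[mu2]_p (F (c1 * p.1 + e1, c2 * p.2 + e2)%R * (`|c1 * c2|)%:E) =
  \int[mu2]_p F p.
Proof.
move=> c10 c20 mF F0.
rewrite -(@ge0_integral_affine1 F (cst c1) (cst e1))//; last first.
  by move=> ? /eqP; rewrite (negbTE c10).
rewrite -[RHS](@ge0_integral_affine2 _ (cst c2) (cst e2))//=.
- by apply: eq_integral => p _; rewrite normrM EFinM muleA.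
- apply: measurable_fun_comp_pairM => //.
  by apply: measurable_funD => //; exact: measurable_funM.
- by move=> p; rewrite mule_ge0.
- by move=> ? /eqP; rewrite (negbTE c20).
Qed.

(** If [c != 0], the rotation is [(x, y) |-> (c * x - s * y, y)] followed by
    [(x, y) |-> (x, (y + s * x) / c)], and the two Jacobians cancel. If [c = 0], it exchanges the
    coordinates up to signs. *)
Lemma ge0_integral_rotation F (c s : R) : (c ^+ 2 + s ^+ 2 = 1)%R ->
    measurable_fun [set: R * R] F -> (forall p, 0 <= F p) ->
  \int[mu2]_p F (c * p.1 - s * p.2, s * p.1 + c * p.2)%R = \int[mu2]_p F p.
Proof.
move=> cs mF F0; have [c0|c0] := eqVneq c 0%R.
  have s0 : s != 0%R.
    apply: contra_eqN cs => /eqP ->; rewrite c0 expr0n/= addr0.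
    by rewrite eq_sym oner_eq0.
  have s1 : (`|s * - s| = 1)%R.
    by rewrite mulrN normrN -expr2 ger0_norm ?sqr_ge0// -cs c0 expr0n add0r.
  transitivity (\int[mu2]_p F (p.2, p.1)); last first.
    rewrite [RHS]fubini_tonelli1// [LHS]fubini_tonelli2//.
    by apply: (measurableT_comp mF); exact: measurable_fun_pair.
  rewrite -[RHS](@ge0_integral_diag _ s (- s) 0 0)//; last 2 first.
  - by rewrite oppr_eq0.
  - by apply: (measurableT_comp mF); exact: measurable_fun_pair.
  apply: eq_integral => p _; rewrite /= s1 mule1 c0; congr F; congr pair; ring.
rewrite -[RHS](@ge0_integral_affine2 _ (fun=> c^-1%R) (fun x => (s / c) * x)%R)//=.
- rewrite -[RHS](@ge0_integral_affine1 _ (fun=> c) (fun y => - s * y)%R)//=.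
  + apply: eq_integral => p _; rewrite -muleA -EFinM -normrM mulVf// normr1 mule1.
    congr F; congr pair; first ring.
    have -> : (c^-1 * p.2 + s / c * (c * p.1 + - s * p.2) =
      s * p.1 + (1 - s ^+ 2) / c * p.2)%R by field.
    by rewrite -cs addrK expr2 mulfK// addrC.
  + apply: measurable_fun_comp_pairM => //.
    by apply: measurable_funD => //; exact: measurable_funM.
  + by move=> p; rewrite mule_ge0.
  + exact: measurable_funM.
  + by move=> y /eqP; rewrite (negbTE c0).
- exact: measurable_funM.
- by move=> x /eqP; rewrite invr_eq0 (negbTE c0).
Qed.

Lemma ge0_integral_inv1 F :
    measurable_fun [set: R * R] F -> (forall p, 0 <= F p) ->
    (forall x y, (x <= 0)%R -> F (x, y) = 0) ->
  \int[mu2]_p (F (p.1^-1, p.2)%R * (p.1 ^- 2)%:E) = \int[mu2]_p F p.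
Proof.
move=> mF F0 Fneg; apply: eq_integral_fiber1 => //.
- apply: measurable_fun_comp_pairM => //.
    by apply: measurableT_comp => //; exact: measurable_invr.
  under eq_fun do rewrite -exprVn; apply: measurable_funX.
  by apply: measurableT_comp => //; exact: measurable_invr.
- by move=> p; rewrite mule_ge0// lee_fin invr_ge0 exprn_even_ge0.
- move=> y /=.
  transitivity (\int[mu]_(x in `]0%R, +oo[) (F (x^-1, y)%R * (x ^- 2)%:E)).
    rewrite [RHS]integral_mkcond; apply: eq_integral => x _.
    rewrite /patch mem_setE in_itv/= andbT; case: ltP => // x0.
    by rewrite Fneg ?mul0e// invr_le0.
  rewrite (@ge0_integral_inv _ (fun x => F (x, y)))//; last exact: measurableT_comp.
  rewrite integral_mkcond; apply: eq_integral => x _.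
  by rewrite /patch mem_setE in_itv/= andbT; case: ltP => // x0; rewrite Fneg.
Qed.

(* In the coordinates [(x, s = y / x)] the inversion [z |-> 1 / z] of the right
   half-plane becomes [(x, s) |-> (1 / ((1 + s ^+ 2) * x), - s)], which changes
   one variable at a time. *)
Lemma ge0_integral_inversion F :
    measurable_fun [set: R * R] F -> (forall p, 0 <= F p) ->
    (forall x y, (x <= 0)%R -> F (x, y) = 0) ->
  \int[mu2]_p (F (p.1 / (p.1 ^+ 2 + p.2 ^+ 2), - p.2 / (p.1 ^+ 2 + p.2 ^+ 2))%R *
    ((p.1 ^+ 2 + p.2 ^+ 2) ^- 2)%:E) = \int[mu2]_p F p.
Proof.
move=> mF F0 Fneg.
have mV : measurable_fun [set: R * R] (fun p => p.1^-1)%R.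
  by apply: measurableT_comp => //; exact: measurable_invr.
(* [F1] is the integrand in the coordinates [(x, s)], [F2] the one after [x |-> 1 / x] and [F3] the
   one after [x |-> (1 + s ^+ 2) * x]. The last substitution [s = - y / x] returns to Cartesian
   coordinates and brings in the sign of the second component. *)
pose F1 p := F (p.1, p.1 * p.2)%R * `|p.1|%:E.
have mF1 : measurable_fun [set: R * R] F1.
  apply: measurable_fun_comp_pairM => //; first exact: measurable_funM.
  exact: measurableT_comp.
have F10 p : 0 <= F1 p by rewrite mule_ge0.
have F1neg x y : (x <= 0)%R -> F1 (x, y) = 0 by move=> x0; rewrite /F1/= Fneg ?mul0e.
pose F2 p := F1 (p.1^-1, p.2)%R * (p.1 ^- 2)%:E.
have mF2 : measurable_fun [set: R * R] F2.
  apply: measurable_fun_comp_pairM => //.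
  by under eq_fun do rewrite -exprVn; exact: measurable_funX.
have F20 p : 0 <= F2 p by rewrite mule_ge0// lee_fin invr_ge0 exprn_even_ge0.
have F2neg x y : (x <= 0)%R -> F2 (x, y) = 0.
  by move=> x0; rewrite /F2/= F1neg ?mul0e// invr_le0.
pose k (s : R) : R := (1 + s ^+ 2)%R.
have k0 s : (0 < k s)%R by rewrite ltr_pwDl// sqr_ge0.
have mk : measurable_fun [set: R] k.
  by apply: measurable_funD => //; exact: measurable_funX.
pose F3 p := F2 (k p.2 * p.1 + 0, p.2)%R * `|k p.2|%:E.
have mF3 : measurable_fun [set: R * R] F3.
  have mk2 : measurable_fun [set: R * R] (fun p => k p.2) by exact: measurableT_comp.
  apply: measurable_fun_comp_pairM => //.
    by apply: measurable_funD => //; exact: measurable_funM.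
  exact: measurableT_comp.
have F30 p : 0 <= F3 p by rewrite mule_ge0.
have F3neg x y : (x <= 0)%R -> F3 (x, y) = 0.
  by move=> x0; rewrite /F3/= F2neg ?mul0e// addr0 pmulr_rle0.
have -> : \int[mu2]_p F p = \int[mu2]_p F1 p.
  rewrite -(@ge0_integral_affine2 F id (cst 0%R))//=.
    by apply: eq_integral => p _; rewrite addr0.
  by move=> x -> y; rewrite Fneg.
rewrite -[RHS]ge0_integral_inv1// -/(F2 _).
rewrite -[RHS](@ge0_integral_affine1 F2 k (cst 0%R))//=; last first.
  by move=> y /eqP; rewrite gt_eqF.
rewrite -[RHS](@ge0_integral_affine2 F3 (fun x => - x^-1)%R (cst 0%R))//=; last 2 first.
- by apply: measurableT_comp => //; exact: measurable_invr.
- move=> x /eqP; rewrite oppr_eq0 invr_eq0 => /eqP -> y; exact: F3neg.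
apply: eq_integral => -[u v] _ /=.
have [u0|u0] := leP u 0%R.
  rewrite F3neg// mul0e Fneg ?mul0e// mulr_le0_ge0// invr_ge0.
  by rewrite addr_ge0 ?sqr_ge0.
rewrite /F3 /F2 /F1 /k /= !addr0 -!muleA -!EFinM.
have n0 : (0 < u ^+ 2 + v ^+ 2)%R by rewrite ltr_pwDl ?sqr_ge0// exprn_gt0.
have un0 : u != 0%R by rewrite gt_eqF.
have nn0 : (u ^+ 2 + v ^+ 2)%R != 0%R by rewrite gt_eqF.
have kE : (1 + (- u^-1 * v) ^+ 2 = (u ^+ 2 + v ^+ 2) / u ^+ 2)%R by field.
have kuE : ((u ^+ 2 + v ^+ 2) / u ^+ 2 * u = (u ^+ 2 + v ^+ 2) / u)%R by field.
rewrite kE kuE normrN !gtr0_norm ?invr_gt0 ?divr_gt0 ?exprn_gt0//.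
congr (F _ * _%:E).
  by congr pair; field; rewrite ?un0 ?nn0.
by field; rewrite un0 nn0.
Qed.

(* The disk automorphism [z |-> (z - a) / (1 - a * z)] is
   [z |-> - 1 / a + k / (1 / a - z)] with [k = (1 - a ^+ 2) / a ^+ 2]. *)
Lemma ge0_integral_disk_automorphism F (a : R) : (0 < a < 1)%R ->
    measurable_fun [set: R * R] F -> (forall p, 0 <= F p) ->
    (forall x y, (1 <= x ^+ 2 + y ^+ 2)%R -> F (x, y) = 0) ->
    let k := ((1 - a ^+ 2) / a ^+ 2)%R in
    let n p := ((a^-1 - p.1) ^+ 2 + p.2 ^+ 2)%R in
  \int[mu2]_p (F (k * ((a^-1 - p.1) / n p) - a^-1, k * (p.2 / n p))%R *
    ((k / n p) ^+ 2)%:E) = \int[mu2]_p F p.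
Proof.
move=> /andP[a0 a1] mF F0 Fout k n.
have k0 : (0 < k)%R.
  by rewrite divr_gt0 ?exprn_gt0// subr_gt0 expr_lt1// ltW.
have kn0 : k != 0%R by rewrite gt_eqF.
pose F1 p := F (k * p.1 + - a^-1, k * p.2 + 0)%R * `|k * k|%:E.
have mF1 : measurable_fun [set: R * R] F1.
  apply: measurable_fun_comp_pairM => //.
    by apply: measurable_funD => //; exact: measurable_funM.
  by apply: measurable_funD => //; exact: measurable_funM.
have F10 p : 0 <= F1 p by rewrite mule_ge0.
(* The affine map sends the left half-plane to real parts at most [- a^-1], outside the disk, so the
   inversion only acts on the right half-plane. *)
have F1neg x y : (x <= 0)%R -> F1 (x, y) = 0.
  move=> x0; rewrite /F1/= Fout ?mul0e//.
  rewrite -[leLHS]addr0 lerD ?sqr_ge0//.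
  have : (1 <= (a^-1 - k * x))%R.
    rewrite -[leLHS]addr0 lerD//; first by rewrite invf_ge1// ltW.
    by rewrite oppr_ge0 pmulr_rle0.
  by rewrite -sqrrN opprD opprK addrC => h; rewrite expr_ge1// (le_trans _ h).
rewrite -(@ge0_integral_diag F k k (- a^-1) 0)//.
rewrite -[RHS]ge0_integral_inversion//.
set G := (X in _ = \int[_]_p X p).
have mn : measurable_fun [set: R * R] (fun p : R * R => p.1 ^+ 2 + p.2 ^+ 2)%R.
  by apply: measurable_funD; apply: measurable_funX.
have mVn : measurable_fun [set: R * R] (fun p : R * R => (p.1 ^+ 2 + p.2 ^+ 2)^-1)%R.
  exact: (measurableT_comp measurable_invr).
have mG : measurable_fun [set: R * R] G.
  apply: (@measurable_fun_comp_pairM F1 (fun p => p.1 / (p.1 ^+ 2 + p.2 ^+ 2))%R (fun p => - p.2 / (p.1 ^+ 2 + p.2 ^+ 2))%R (fun p => (p.1 ^+ 2 + p.2 ^+ 2) ^- 2)%R) => //.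
  - exact: measurable_funM.
  - by apply: measurable_funM => //; exact: measurableT_comp.
  - by under eq_fun do rewrite -exprVn; exact: measurable_funX.
rewrite -[RHS](@ge0_integral_diag _ (-1) (-1) a^-1 0)//;
  last by move=> p; apply: mule_ge0; [exact: F10|rewrite lee_fin invr_ge0 sqr_ge0].
apply: eq_integral => -[x y] _.
rewrite /G /F1 /n /= !addr0 !mulN1r sqrrN !opprK [(- x + _)%R]addrC.
rewrite normr1 mule1 -muleA -EFinM.
congr (F _ * _%:E).
by rewrite (ger0_norm (ltW (mulr_gt0 k0 k0))) expr_div_n expr2.
Qed.

End planar_substitution.

(** * Complex functions of a real pair *)

Section planar_measurability.
Context {R : realType}.

(** [U] is the union of the boxes with rational corners that it contains; the other boxes are
    replaced by the empty set, so that the index type stays countable. *)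
Lemma open_measurable_prod (U : set (R * R)) : open U -> measurable U.
Proof.
move=> oU; pose box (q : (rat * rat) * (rat * rat)) : set (R * R) :=
  `]ratr q.1.1, ratr q.1.2[%classic `*` `]ratr q.2.1, ratr q.2.2[%classic.
rewrite (_ : U = \bigcup_q (if `[<box q `<=` U>] then box q else set0)).
  apply: countable_bigcupT_measurable => // q; case: ifP => // _.
  by apply: measurableX; exact: measurable_itv.
apply/seteqP; split => [[x y] Uxy|p [q _]]; last by case: asboolP => // qU; exact: qU.
have /nbhs_ballP[e /= e0 exyU] : nbhs (x, y) U by exact: open_nbhs_nbhs.
have rat_between (a b : R) : a < b -> exists q : rat, a < ratr q < b.
  by move=> /rat_in_itvoo[q]; rewrite in_itv/=; exists q.
have [q1 /andP[l1 u1]] : exists q : rat, x - e < ratr q < x.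
  by apply: rat_between; rewrite ltrBlDr ltrDl.
have [q2 /andP[l2 u2]] : exists q : rat, x < ratr q < x + e.
  by apply: rat_between; rewrite ltrDl.
have [q3 /andP[l3 u3]] : exists q : rat, y - e < ratr q < y.
  by apply: rat_between; rewrite ltrBlDr ltrDl.
have [q4 /andP[l4 u4]] : exists q : rat, y < ratr q < y + e.
  by apply: rat_between; rewrite ltrDl.
exists ((q1, q2), (q3, q4)) => //; case: asboolP => [_|].
  by split; rewrite /= in_itv/= ?u1 ?u2 ?u3 ?u4.
case=> -[v w] [/=]; rewrite !in_itv/= => /andP[? ?] /andP[? ?].
by apply: exyU; split; rewrite /ball/= ltr_norml; apply/andP; split; lra.
Qed.

Lemma continuous_measurable_prod (U : set (R * R)) (u : R * R -> R) :
  open U -> (forall p, U p -> {for p, continuous u}) -> measurable_fun U u.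
Proof.
move=> oU cu; apply: (measurability _ (RGenOInfty.measurableE R)) => //.
move=> /= _ [_ [a ->] <-]; apply: open_measurable_prod.
rewrite openE => p [Up /=]; rewrite in_itv/= andbT => aup.
apply: filterI; first exact: open_nbhs_nbhs.
near=> q; rewrite /= in_itv/= andbT.
by near: q; apply: (cvgr_gt (u p) (cu p Up)).
Unshelve. all: by end_near. Qed.

End planar_measurability.

(** * Topology of the complex plane in real coordinates *)

Section complex_topology.
Context {R : realType}.
Local Notation C := R[i].

Lemma normC_modulus (z : C) : `|z| = (modulus z)%:C.
Proof. by case: z. Qed.

Lemma modulus_sqr (z : C) : modulus z ^+ 2 = Re z ^+ 2 + Im z ^+ 2.
Proof. by case: z => x y /=; rewrite sqr_sqrtr ?addr_ge0 ?sqr_ge0. Qed.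

Lemma modulus_ge0 (z : C) : 0 <= modulus z.
Proof. by case: z => x y; exact: sqrtr_ge0. Qed.

Lemma modulusM (z w : C) : modulus (z * w) = modulus z * modulus w.
Proof. exact: ComplexField.Normc.normcM. Qed.

Lemma modulusV (z : C) : modulus z^-1 = (modulus z)^-1.
Proof. exact: ComplexField.Normc.normcV. Qed.

Lemma modulus_real (x : R) : modulus x%:C = `|x|.
Proof. by rewrite /modulus/= expr0n/= addr0 sqrtr_sqr. Qed.

Lemma unit_diskE (x y : R) : unit_disk (x +i* y) <-> x ^+ 2 + y ^+ 2 < 1.
Proof.
rewrite /unit_disk/= normC_modulus ltcR.
by rewrite -[x ^+ 2 + y ^+ 2](modulus_sqr (x +i* y)) expr_lt1// modulus_ge0.
Qed.

Lemma continuous_real_complex : continuous (real_complex R : R -> C).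
Proof.
move=> x; apply/cvgrPdist_lt => e /=; rewrite ltcE/= => /andP[/eqP ie0 re0].
have eE : e = (Re e)%:C by apply/eqP; rewrite eq_complex/= ie0 !eqxx.
near=> y; rewrite -rmorphB/= normC_modulus modulus_real eE ltcR.
by near: y; apply: cvgr_dist_lt.
Unshelve. all: by end_near. Qed.

Lemma continuous_modulus : continuous (@modulus R).
Proof.
move=> z; apply/(cvgrPdist_lt (F := nbhs z)) => e e0 /=.
have e0' : 0 < e%:C by rewrite ltcR.
near=> w; rewrite -ltcR -modulus_real -normC_modulus rmorphB/= -!normC_modulus.
apply: le_lt_trans (ler_dist_dist _ _) _.
by near: w; exact: cvgr_dist_lt.
Unshelve. all: by end_near. Qed.

Lemma norm_Re_le (z : C) : `|Re z| <= modulus z.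
Proof.
rewrite -[leRHS]ger0_norm ?modulus_ge0// -ler_sqr ?nnegrE//.
by rewrite !real_normK ?num_real// modulus_sqr lerDl sqr_ge0.
Qed.

Lemma norm_Im_le (z : C) : `|Im z| <= modulus z.
Proof.
rewrite -[leRHS]ger0_norm ?modulus_ge0// -ler_sqr ?nnegrE//.
by rewrite !real_normK ?num_real// modulus_sqr lerDr sqr_ge0.
Qed.

Lemma continuous_Re : continuous (@Re R : C -> R).
Proof.
move=> z; apply/(cvgrPdist_lt (F := nbhs z)) => e e0 /=.
have e0' : 0 < e%:C by rewrite ltcR.
near=> w; rewrite -ltcR (_ : Re z - Re w = Re (z - w)); last by case: (z) (w) => ? ? [].
apply: (@le_lt_trans _ _ `|z - w|); first by rewrite normC_modulus lecR norm_Re_le.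
by near: w; exact: cvgr_dist_lt.
Unshelve. all: by end_near. Qed.

Lemma continuous_Im : continuous (@Im R : C -> R).
Proof.
move=> z; apply/(cvgrPdist_lt (F := nbhs z)) => e e0 /=.
have e0' : 0 < e%:C by rewrite ltcR.
near=> w; rewrite -ltcR (_ : Im z - Im w = Im (z - w)); last by case: (z) (w) => ? ? [].
apply: (@le_lt_trans _ _ `|z - w|); first by rewrite normC_modulus lecR norm_Im_le.
by near: w; exact: cvgr_dist_lt.
Unshelve. all: by end_near. Qed.

Lemma continuous_complex : continuous (fun p : R * R => p.1 +i* p.2 : C).
Proof.
rewrite (_ : (fun p : R * R => _) =
    (fun p : R * R => p.1%:C + 'i%C * p.2%:C)); last first.
  by apply/funext => -[x y]; rewrite [LHS]complexE.
move=> p; apply: cvgD.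
  apply: (@continuous_comp _ _ _ fst (real_complex R)); first exact: cvg_fst.
  exact: continuous_real_complex.
apply: cvgM; first exact: cvg_cst.
apply: (@continuous_comp _ _ _ snd (real_complex R)); first exact: cvg_snd.
exact: continuous_real_complex.
Qed.

End complex_topology.

(** * Differentiability over a numeric field *)

Section derivable_facts.

(** Multiplying the difference quotient by [h] removes the puncture, as the bound is trivial at
    [h = 0]. In this form real estimates can be added up to a complex one. *)
Lemma is_derive_le_linear (K : numFieldType) (f : K -> K) (x l : K) :
  is_derive x 1 f l <->
  forall e, 0 < e -> \forall h \near 0, `|f (h + x) - f x - h * l| <= e * `|h|.
Proof.
split.
  move=> [df dE] e e0.
  have : (fun h => h^-1 *: ((f \o shift x) (h *: 1) - f x)) @ 0^' --> l by rewrite -dE.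
  move=> /cvgrPdist_le/(_ e e0); rewrite near_withinE; apply: filterS => h /= H.
  have [->|h0] := eqVneq h 0; first by rewrite add0r subrr mul0r subr0 normr0 mulr0.
  have := H h0; rewrite -(ler_pM2r (_ : 0 < `|h|)) ?normr_gt0//.
  rewrite -normrM mulrBl /GRing.scale/= mulr1 mulrAC mulVf// mul1r.
  by rewrite distrC (mulrC l).
move=> H.
have lim : (fun h => h^-1 *: ((f \o shift x) (h *: 1) - f x)) @ 0^' --> l.
  apply/cvgrPdist_le => e e0; rewrite near_withinE; apply: filterS (H e e0) => h /= He h0.
  rewrite -(ler_pM2r (_ : 0 < `|h|)) ?normr_gt0//.
  rewrite -normrM mulrBl /GRing.scale/= mulr1 mulrAC mulVf// mul1r.
  by rewrite distrC (mulrC l).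
by apply: DeriveDef; [apply/cvg_ex; exists l|exact: cvg_lim lim].
Qed.

Lemma derivable_comp1 (K : numFieldType) (f g : K -> K) (x : K) :
  derivable g x 1 -> derivable f (g x) 1 -> derivable (f \o g) x 1.
Proof.
move=> /derivable1_diffP dg /derivable1_diffP df.
by apply/derivable1_diffP; exact: differentiable_comp.
Qed.

Lemma derivable_continuous1 (K : numFieldType) (f : K -> K) (x : K) :
  derivable f x 1 -> {for x, continuous f}.
Proof. by move=> /derivable1_diffP/differentiable_continuous. Qed.

(** The increment [k h] of [L] tends to 0 by continuity and is nonzero for small [h != 0], since [E]
    recovers [h + z] from [L (h + z)]. The difference quotient of [L] is therefore the inverse of
    that of [E] along [k]. *)
Lemma derivable_right_inverse (K : numFieldType) (E L : K -> K) (z d : K) :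
  {for z, continuous L} -> (\forall w \near z, E (L w) = w) ->
  is_derive (L z) 1 E d -> d != 0 -> derivable L z 1.
Proof.
move=> cL EL [dE dEd] d0.
have ELz : E (L z) = z by exact: nbhs_singleton EL.
pose k h := L (h + z) - L z.
have addz : (h + z) @[h --> 0] --> z.
  have : (h + z) @[h --> 0] --> 0 + z; last by rewrite add0r.
  apply: (cvgD (F := nbhs (0 : K)) (f := id) (g := cst z)) => //.
  exact: cvg_cst.
have EL0 : \forall h \near 0, E (L (h + z)) = h + z by exact: addz EL.
have EL0' : \forall h \near 0^', E (L (h + z)) = h + z.
  by rewrite near_withinE; apply: filterS EL0 => h Eh _.
have limE : (fun h => h^-1 *: ((E \o shift (L z)) (h *: 1) - E (L z))) @ 0^' --> d.
  by rewrite -dEd.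
have kh0 : \forall h \near 0^', k h != 0.
  rewrite near_withinE; near=> h => h0; rewrite subr_eq0.
  apply: contra_neq h0 => Lhz; have : E (L (h + z)) = h + z by near: h.
  by rewrite Lhz ELz => /eqP; rewrite eq_sym -subr_eq0 addrK => /eqP.
have limk : k h @[h --> 0^'] --> 0^'.
  have kc : k h @[h --> 0] --> L z - L z.
    apply: (cvgB (F := nbhs (0 : K)) (f := fun h => L (h + z)) (g := cst (L z))).
      exact: (cvg_comp _ _ addz cL).
    exact: cvg_cst.
  rewrite subrr in kc; have : k h @[h --> 0^'] --> 0.
    move=> P /kc kP; suff : \forall h \near 0^', P (k h) by []; rewrite near_withinE.
    have : \forall h \near 0, P (k h) by exact: kP.
    by apply: filterS => h Ph _.
  move=> k0 P Pnbhs.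
  have kP : \forall h \near 0^', k h != 0 -> P (k h) by exact: k0 Pnbhs.
  suff : \forall h \near 0^', P (k h) by [].
  by apply: filterS2 kh0 kP => h /[swap].
have lim : (fun h => (k h)^-1 * h) @ 0^' --> d.
  apply: (cvg_trans _ (cvg_comp _ _ limk limE)); apply: near_eq_cvg; near=> h.
  rewrite /= /GRing.scale/= mulr1 ELz /k subrK.
  suff -> : E (L (h + z)) = h + z by rewrite addrK.
  by near: h.
apply/cvg_ex; exists d^-1.
have limV := @cvgV K K (dnbhs (0 : K)) (dnbhs_filter _) _ d d0 lim.
apply: cvg_trans limV; apply: near_eq_cvg; near=> h.
by rewrite /= /GRing.scale/= mulr1 /unstable.inv_fun invfM invrK mulrC.
Unshelve. all: by end_near. Qed.

End derivable_facts.

Section disk_measurability.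
Context {R : realType}.
Local Notation C := R[i].

Definition planar_disk : set (R * R) := [set p | unit_disk (p.1 +i* p.2)].

Lemma open_planar_disk : open planar_disk.
Proof.
rewrite openE => p Dp.
have mp : modulus (p.1 +i* p.2) < 1 by move: Dp; rewrite /planar_disk/= /unit_disk/= normC_modulus ltcR.
have := @continuous_comp _ _ _ (fun p : R * R => p.1 +i* p.2 : C) (@modulus R) p
  (@continuous_complex R p) (@continuous_modulus R _).
move=> /cvgr_lt/(_ _ mp); apply: filterS => q /= mq.
by rewrite /planar_disk/= /unit_disk/= normC_modulus ltcR.
Qed.

Lemma measurable_planar_disk : measurable planar_disk.
Proof. by apply: open_measurable_prod; exact: open_planar_disk. Qed.

Lemma measurable_modulus_analytic (phi : C -> C) : analytic_on (@unit_disk R) phi ->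
  measurable_fun planar_disk (fun p => modulus (phi (p.1 +i* p.2))).
Proof.
move=> aphi; apply: continuous_measurable_prod; first exact: open_planar_disk.
move=> p Dp.
apply: (@continuous_comp _ _ _ (fun p : R * R => p.1 +i* p.2 : C) (@modulus R \o phi)).
  exact: continuous_complex.
apply: (@continuous_comp _ _ _ phi (@modulus R)); last exact: continuous_modulus.
exact/derivable_continuous1/aphi.
Qed.

End disk_measurability.

(** * Real powers on the right half-plane *)

Section complex_power.
Context {R : realType}.
Local Notation C := R[i].

Lemma modulus_le_add (z : C) : modulus z <= `|Re z| + `|Im z|.
Proof.
rewrite -ler_sqr ?nnegrE ?modulus_ge0 ?addr_ge0// modulus_sqr sqrrD.
by rewrite !real_normK ?num_real// lerD2r lerDl mulrn_wge0// mulr_ge0.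
Qed.

Definition cexp (z : C) : C :=
  (expR (Re z) * cos (Im z)) +i* (expR (Re z) * sin (Im z)).

Lemma cexpD (z w : C) : cexp (z + w) = cexp z * cexp w.
Proof.
case: z w => [x y] [u v]; rewrite /cexp/= expRD cosD sinD.
by apply/eqP; rewrite eq_complex/=; apply/andP; split; apply/eqP; ring.
Qed.

Lemma cexp0 : cexp 0 = 1.
Proof. by rewrite /cexp/= expR0 cos0 sin0 mulr1 mulr0. Qed.

Lemma modulus_cexp (z : C) : modulus (cexp z) = expR (Re z).
Proof.
apply: (@pexpIrn _ 2); rewrite ?nnegrE ?modulus_ge0 ?expR_ge0// modulus_sqr/=.
by rewrite !exprMn -mulrDr cos2Dsin2 mulr1.
Qed.

Lemma complex_pos_real (e : C) : 0 < e -> (0 < Re e) /\ e = (Re e)%:C.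
Proof.
by rewrite ltcE/= => /andP[/eqP ie0 ->]; split => //; apply/eqP; rewrite eq_complex/= ie0 !eqxx.
Qed.

Lemma near0_ReIm (P Q : R -> Prop) :
  (\forall t \near 0, P t) -> (\forall t \near 0, Q t) ->
  \forall h \near (0 : C), P (Re h) /\ Q (Im h).
Proof.
move=> P0 Q0; apply: filterI.
  exact: (@continuous_Re R 0 P P0).
exact: (@continuous_Im R 0 Q Q0).
Qed.

Let is_derive_cexp0 : is_derive (0 : C) 1 cexp 1.
Proof.
apply/is_derive_le_linear => e /complex_pos_real[e0 ->].
(* The real and the imaginary part of the error will each cost at most three times
   [n * modulus h]. *)
set n := Re e / 6.
have n0 : 0 < n by rewrite divr_gt0.
have E1 : \forall t \near (0 : R), `|expR t - 1 - t| <= n * `|t|.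
  have /is_derive_le_linear/(_ n n0) := is_derive_expR (0 : R).
  by apply: filterS => t; rewrite addr0 expR0 mulr1.
have E2 : \forall t \near (0 : R), `|cos t - 1| <= n * `|t|.
  have /is_derive_le_linear/(_ n n0) := is_derive_cos (0 : R).
  by apply: filterS => t; rewrite addr0 cos0 sin0 oppr0 mulr0 subr0.
have E3 : \forall t \near (0 : R), `|sin t - t| <= n * `|t|.
  have /is_derive_le_linear/(_ n n0) := is_derive_sin (0 : R).
  by apply: filterS => t; rewrite addr0 cos0 sin0 subr0 mulr1.
have E4 : \forall t \near (0 : R), `|expR t - 1| <= Num.min n 1.
  have : expR t @[t --> (0 : R)] --> expR 0 by exact: continuous_expR.
  move=> /cvgrPdist_le/(_ (Num.min n 1)); rewrite lt_min n0 ltr01 => /(_ erefl).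
  by apply: filterS => t; rewrite expR0 distrC.
have := near0_ReIm (@filterI _ _ (nbhs_filter (0 : R)) _ _ E1 E4) (@filterI _ _ (nbhs_filter (0 : R)) _ _ E2 E3).
apply: (filterS (F := nbhs (0 : C))) => -[x y] /= [[X1 X4] [Y2 Y3]].
rewrite addr0 cexp0 mulr1 !normC_modulus -rmorphM/= lecR.
have [X5 X6] : `|expR x - 1| <= n /\ expR x <= 2.
  move: X4; rewrite le_min => /andP[-> h]; split => //.
  by have := le_trans (ler_norm _) h; lra.
have x0 := expR_ge0 x.
apply: (le_trans (modulus_le_add
  ((expR x * cos y - 1 - x) +i* (expR x * sin y - 0 - y)))) => /=.
rewrite -/(modulus (x +i* y)).
have xm : `|x| <= modulus (x +i* y) := norm_Re_le (x +i* y).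
have ym : `|y| <= modulus (x +i* y) := norm_Im_le (x +i* y).
have -> : expR x * cos y - 1 - x = expR x * (cos y - 1) + (expR x - 1 - x) by ring.
have -> : expR x * sin y - 0 - y = expR x * (sin y - y) + (expR x - 1) * y by ring.
have B1 : `|expR x * (cos y - 1) + (expR x - 1 - x)| <= 2 * (n * `|y|) + n * `|x|.
  rewrite (le_trans (ler_normD _ _))// lerD// normrM (ger0_norm x0).
  by rewrite ler_pM.
have B2 : `|expR x * (sin y - y) + (expR x - 1) * y| <= 2 * (n * `|y|) + n * `|y|.
  rewrite (le_trans (ler_normD _ _))// lerD// normrM ?(ger0_norm x0).
    by rewrite ler_pM.
  by rewrite ler_wpM2r.
apply: le_trans (lerD B1 B2) _.
have nx : n * `|x| <= n * modulus (x +i* y) by rewrite ler_pM2l.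
have ny : n * `|y| <= n * modulus (x +i* y) by rewrite ler_pM2l.
have -> : Re e * modulus (x +i* y) = 6 * (n * modulus (x +i* y)).
  by rewrite /n; field.
lra.
Qed.

Lemma is_derive_cexp (z : C) : is_derive z 1 cexp (cexp z).
Proof.
apply/is_derive_le_linear => e e0.
have ez0 : 0 < `|cexp z|.
  by rewrite normC_modulus ltcR modulus_cexp expR_gt0.
have /is_derive_le_linear/(_ (e / `|cexp z|)) := is_derive_cexp0.
rewrite divr_gt0// => /(_ erefl); apply: filterS => h.
rewrite addr0 cexp0 mulr1 => H.
rewrite cexpD (_ : _ - _ = (cexp h - 1 - h) * cexp z); last by ring.
rewrite normrM -ler_pdivlMr//; apply: le_trans H _.
by rewrite mulrAC.
Qed.

(** The principal logarithm on the right half-plane, where [atan] gives the argument. *)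
Definition clog (z : C) : C := ln (modulus z) +i* atan (Im z / Re z).

Lemma clogK (z : C) : 0 < Re z -> cexp (clog z) = z.
Proof.
case: z => x y /= x0; rewrite /cexp/= lnK; last first.
  by rewrite posrE sqrtr_gt0 ltr_pwDl ?sqr_ge0// exprn_gt0.
set t := atan _.
have m0 : 0 < x ^+ 2 + y ^+ 2 by rewrite ltr_pwDl ?sqr_ge0// exprn_gt0.
have ct : cos t = x / Num.sqrt (x ^+ 2 + y ^+ 2).
  rewrite /t cos_atan (_ : 1 + _ = (x ^+ 2 + y ^+ 2) / x ^+ 2); last first.
    by field; rewrite gt_eqF.
  by rewrite sqrtrM ?ltW// sqrtrV ?sqr_ge0// sqrtr_sqr gtr0_norm// invf_div.
have st : sin t = y / x * cos t.
  have ct0 : cos t != 0 by rewrite ct gt_eqF// divr_gt0// sqrtr_gt0.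
  by rewrite -[y / x](atanK) -/t /tan divfK.
have s0 : Num.sqrt (x ^+ 2 + y ^+ 2) != 0 by rewrite gt_eqF// sqrtr_gt0.
have x0' : x != 0 by rewrite gt_eqF.
by rewrite st ct; apply/eqP; rewrite eq_complex/=; apply/andP; split; apply/eqP; field;
   rewrite ?x0' ?s0.
Qed.

Lemma derivable_clog (z : C) : 0 < Re z -> derivable clog z 1.
Proof.
move=> z0.
have nz : \forall w \near z, 0 < Re w by exact: (cvgr_gt (Re z) (@continuous_Re R z)).
have zn0 : z != 0 by apply: contraTneq z0 => ->; rewrite ltxx.
have mz : 0 < modulus z by rewrite -ltcR -normC_modulus normr_gt0.
apply: (@derivable_right_inverse _ cexp clog z z) => //.
- have c1 : {for z, continuous (fun w : C => ln (modulus w))}.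
    apply: (@continuous_comp _ _ _ (@modulus R) (@ln R)); first exact: continuous_modulus.
    exact: continuous_ln.
  have c2 : {for z, continuous (fun w : C => atan (Im w / Re w))}.
    apply: (@continuous_comp _ _ _ (fun w : C => Im w / Re w) (@atan R)).
      apply: (@cvgM _ _ (nbhs z) _ (@Im R) (fun w => (Re w)^-1)).
        exact: continuous_Im.
      apply: (@cvgV _ _ (nbhs z) _ (@Re R)); first by rewrite gt_eqF.
      exact: continuous_Re.
    exact: continuous_atan.
  apply: (@continuous_comp _ _ _ (fun w : C => (ln (modulus w), atan (Im w / Re w)))
    (fun p : R * R => p.1 +i* p.2 : C)); last exact: continuous_complex.
  exact: (@cvg_pair _ _ _ (nbhs z) (nbhs _) (nbhs _) _ _ _ _ _ c1 c2).
- by apply: filterS nz => w; exact: clogK.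
- by rewrite -{2}(clogK z0); exact: is_derive_cexp.
Qed.

Definition cpow (s : R) (z : C) : C := cexp (s%:C * clog z).

Lemma derivable_cpow (s : R) (z : C) : 0 < Re z -> derivable (cpow s) z 1.
Proof.
move=> z0; apply: (@derivable_comp1 _ cexp (fun w => s%:C * clog w)).
  by apply: derivableM; [exact: derivable_cst|exact: derivable_clog].
by have [] := is_derive_cexp (s%:C * clog z).
Qed.

Lemma modulus_cpow (s : R) (z : C) : 0 < Re z -> modulus (cpow s z) = modulus z `^ s.
Proof.
move=> z0; rewrite /cpow modulus_cexp/= mul0r subr0 /powR gt_eqF//.
rewrite -ltcR -normC_modulus normr_gt0.
by apply: contraTneq z0 => ->; rewrite ltxx.
Qed.

End complex_power.

(** * Schwarzian derivatives of rational functions *)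

Section rational_derivatives.
Context {K : numFieldType}.
Implicit Types (A B : {poly K}) (z : K).

Lemma is_derive_horner A z : is_derive z 1 (horner A) A^`().[z].
Proof.
elim/poly_ind: A => [|A c IH].
  rewrite deriv0 horner0 (_ : horner 0 = cst 0); first exact: is_derive_cst.
  by apply/funext => w; rewrite horner0.
rewrite (_ : horner (A * 'X + c%:P) = (fun w => A.[w] * w + c)); last first.
  by apply/funext => w; rewrite !hornerE.
have dA : is_derive z 1 (fun w => A.[w] * w) (A.[z] *: 1 + z *: A^`().[z]).
  exact: (is_deriveM (g := id)).
have dc : is_derive z 1 (cst c) (0 : K) by exact: is_derive_cst.
apply: (is_derive_eq (is_deriveD dA dc)).
by rewrite derivD derivM derivX derivC addr0 hornerD !hornerE /GRing.scale/= mulr1 addrC mulrC.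
Qed.

Lemma continuous_hornerC A : continuous (horner A).
Proof.
by move=> z; apply: derivable_continuous1; have [] := is_derive_horner A z.
Qed.

Lemma near_horner_neq0 A z : A.[z] != 0 -> \forall w \near z, A.[w] != 0.
Proof. exact: (cvgr_neq0 (A.[z]) (@continuous_hornerC A z)). Qed.

Lemma is_derive_ratio A B z : B.[z] != 0 ->
  is_derive z 1 (fun w => A.[w] / B.[w])
    ((A^`() * B - A * B^`()).[z] / B.[z] ^+ 2).
Proof.
move=> Bz.
have dA := is_derive_horner A z; have dB := is_derive_horner B z.
have dV : is_derive z 1 (fun w => B.[w]^-1) (- B.[z] ^- 2 *: B^`().[z]).
  have [d <-] := dB.
  by apply: DeriveDef; [exact: derivableV|rewrite deriveV].
apply: (is_derive_eq (is_deriveM dA dV)).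
rewrite hornerD hornerN !hornerM.
transitivity (A.[z] * (- B.[z] ^- 2 * B^`().[z]) + B.[z]^-1 * A^`().[z]) => //.
by field.
Qed.

Lemma near_derive1_ratio (f : K -> K) A B z : B.[z] != 0 ->
  (\forall w \near z, f w = A.[w] / B.[w]) ->
  derive1 f z = (A^`() * B - A * B^`()).[z] / B.[z] ^+ 2.
Proof.
move=> Bz fE; rewrite derive1E (near_eq_derive _ fE).
by have [_ ->] := is_derive_ratio A Bz.
Qed.

(* The value at a zero of the denominator is the junk value 0, at which a
   fraction in lowest terms is discontinuous. *)
Lemma ratio_continuous_denominator A B z : coprimep A B -> B != 0 ->
  {for z, continuous (fun w => A.[w] / B.[w])} -> B.[z] != 0.
Proof.
move=> cAB B0 cf; apply/negP => /eqP Bz.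
have Az : A.[z] != 0.
  by rewrite coprimep_sym in cAB; apply: (coprimep_root cAB); exact/rootP.
have [m [B1 + BE]] := multiplicity_XsubC B z; rewrite B0/= rootE => B1z.
(* This function is 0 at all nearby points other than [z], but its value at [z] is [- A.[z]], which
   is nonzero. *)
have c : {for z, continuous (fun w => A.[w] / B.[w] * B.[w] - A.[w])}.
  have c1 := @cvgM _ _ (nbhs z) (nbhs_filter z) _ _ _ _ cf (@continuous_hornerC B z).
  exact: (@cvgB _ _ _ (nbhs z) (nbhs_filter z) _ _ _ _ c1 (@continuous_hornerC A z)).
have H1 : \forall w \near z, A.[w] / B.[w] * B.[w] - A.[w] != 0.
  apply: (cvgr_neq0 _ c); by rewrite Bz mulr0 sub0r oppr_eq0.
have H2 : \forall w \near z, B1.[w] != 0 by exact: near_horner_neq0.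
have : \forall w \near z^', False.
  rewrite near_withinE; near=> w => wz.
  suff : A.[w] / B.[w] * B.[w] - A.[w] = 0.
    by apply/eqP; near: w.
  have Bw : B.[w] != 0.
    rewrite BE !hornerE mulf_neq0//; first by near: w.
    by rewrite expf_neq0// subr_eq0.
  by rewrite divfK// subrr.
by move=> /filter_ex[].
Unshelve. all: by end_near. Qed.

End rational_derivatives.

Section rational_schwarzian.
Context {R : realType}.
Local Notation C := R[i].
Implicit Types (p q : {poly C}).

(* The numerator of [f'] for [f = p / q], up to the factor [q ^+ 2]. *)
Definition wronskian p q : {poly C} := p^`() * q - p * q^`().

Lemma derive1_rational (f : C -> C) p q z : (forall w, f w = p.[w] / q.[w]) ->
  q.[z] != 0 -> derive1 f z = (wronskian p q).[z] / q.[z] ^+ 2.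
Proof.
move=> fE qz; rewrite (@near_derive1_ratio _ _ p q)//.
by apply: filterE; exact: fE.
Qed.

(** This is the logarithmic derivative [N' / N - 2 * q' / q] of [N / q ^+ 2], over a common
    denominator. *)
Lemma pre_schwarzian_rational (f : C -> C) p q z :
    (forall w, f w = p.[w] / q.[w]) ->
    let N := wronskian p q in (N * q).[z] != 0 ->
  derive1 (derive1 f) z / derive1 f z =
    (N^`() * q - 2%:P * N * q^`()).[z] / (N * q).[z].
Proof.
move=> fE N; have f1 w : q.[w] != 0 -> derive1 f w = N.[w] / q.[w] ^+ 2.
  exact: derive1_rational.
clearbody N; rewrite hornerM mulf_eq0 negb_or => /andP[Nz qz].
rewrite (@near_derive1_ratio _ _ N (q ^+ 2)); last 2 first.
- by rewrite horner_exp expf_neq0.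
- by apply: filterS (near_horner_neq0 qz) => v qv; rewrite f1// horner_exp.
rewrite f1// horner_exp expr2 derivM !(hornerD, hornerN, hornerM, hornerC).
by field; rewrite Nz qz.
Qed.

Lemma schwarzian_pre_rational (f : C -> C) (A B : {poly C}) (z : C) : B.[z] != 0 ->
    (\forall w \near z, derive1 (derive1 f) w / derive1 f w = A.[w] / B.[w]) ->
  schwarzian f z = ((wronskian A B).[z] - 2^-1 * A.[z] ^+ 2) / B.[z] ^+ 2.
Proof.
move=> Bz fAB; rewrite /schwarzian.
have e1 : derive1 (derive1 f) z / derive1 f z = A.[z] / B.[z].
  exact: (nbhs_singleton fAB).
have e2 : derive1 (fun w => derive1 (derive1 f) w / derive1 f w) z =
    (wronskian A B).[z] / B.[z] ^+ 2.
  exact: near_derive1_ratio Bz fAB.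
apply: (etrans (congr2 (fun u v => u - 2^-1 * v ^+ 2) e2 e1)).
by rewrite expr_div_n mulrA -mulrBl.
Qed.

Lemma schwarzian_koebe (z : C) : unit_disk z ->
  schwarzian (@koebe R) z = - 6 / (1 - z ^+ 2) ^+ 2.
Proof.
move=> z1; have nz (w : C) : unit_disk w -> (1 - w != 0) /\ (1 + w != 0).
  rewrite /unit_disk/= => w1; rewrite subr_eq0 addr_eq0; split.
    by apply: contraTneq w1 => <-; rewrite normr1 ltxx.
  apply: contraTneq w1 => w1; rewrite -(normrN w) -w1 normr1 ltxx//.
pose q : {poly C} := (1 - 'X) * (1 - 'X).
have kE w : koebe w = 'X.[w] / q.[w].
  by rewrite /koebe /q !hornerE expr2.
have NE : wronskian 'X q = (1 - 'X) * (1 + 'X).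
  by rewrite /wronskian /q derivM derivB derivX derivC; ring.
have BE (w : C) : (1 - 'X ^+ 2 : {poly C}).[w] = (1 - w) * (1 + w).
  by rewrite !hornerE; ring.
have [z2 z3] := nz z z1.
(* The logarithmic derivative of [koebe' = (1 + z) / (1 - z) ^+ 3] is
   [1 / (1 + z) + 3 / (1 - z)]. *)
rewrite (@schwarzian_pre_rational _ (4%:P + 2%:P * 'X) (1 - 'X ^+ 2)).
- rewrite /wronskian BE !(derivD, derivN, derivM, derivC, derivX, expr2).
  rewrite !(hornerD, hornerN, hornerM, hornerX, hornerC).
  have -> : 1 - z * z = (1 - z) * (1 + z) by ring.
  by field; rewrite z2 z3.
- by rewrite BE mulf_neq0.
have : \forall w \near z, unit_disk w.
  have mz : modulus z < 1 by rewrite -ltcR -normC_modulus.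
  have mw : \forall w \near z, modulus w < 1.
    exact: (cvgr_lt (modulus z) (@continuous_modulus R z)).
  by apply: filterS mw => w mw; rewrite /unit_disk/= normC_modulus ltcR.
apply: filterS => w /nz[w2 w3].
have qw : (wronskian 'X q * q).[w] != 0.
  by rewrite NE /q !(hornerD, hornerN, hornerM, hornerX, hornerC) !mulf_neq0.
rewrite (pre_schwarzian_rational kE)// BE NE /q.
rewrite !(derivD, derivN, derivM, derivC, derivX).
rewrite !(hornerD, hornerN, hornerM, hornerX, hornerC).
by field; rewrite w2 w3.
Qed.

(* At a zero of order [m >= 1] of [f'] the Schwarzian has a double pole with
   leading coefficient [- (m + m ^+ 2 / 2)]. The bound is an inequality because
   the left-hand side has junk value 0 at zeros of the denominator. *)
Lemma schwarzian_critical_point (f : C -> C) z0 : rational_function f ->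
    derivable f 0 1 -> derive1 f 0 = 1 -> critical_point f z0 ->
  exists T V : {poly C}, [/\ V.[z0] != 0, 3 / 2 <= modulus (T.[z0] / V.[z0]) &
    forall z, modulus (T.[z] / (V.[z] * (z - z0) ^+ 2)) <= modulus (schwarzian f z)].
Proof.
move=> [p [q [q0 cpq fE]]] df0 f'0 [az0 f'z0].
have fE' : f = (fun w => p.[w] / q.[w]) by apply/funext.
have qn0 z : derivable f z 1 -> q.[z] != 0.
  move=> /derivable_continuous1; rewrite fE'; exact: ratio_continuous_denominator.
have q00 := qn0 _ df0.
have qz0 := qn0 _ (nbhs_singleton az0).
set N := wronskian p q.
have N0 : N != 0.
  apply: contra_eq_neq f'0 => N0; rewrite (derive1_rational fE)// -/N N0 horner0 mul0r.
  by rewrite eq_sym oner_eq0.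
have Nz0 : N.[z0] = 0.
  move: f'z0; rewrite (derive1_rational fE)// => /eqP.
  by rewrite mulf_eq0 invr_eq0 expf_eq0/= (negbTE qz0) orbF => /eqP.
have [m [N1 + NE]] := multiplicity_XsubC N z0; rewrite N0/= rootE => N1z0.
have [n mE] : exists n, m = n.+1.
  case: m NE => [|n] NE; last by exists n.
  by move: Nz0; rewrite NE expr0 mulr1 => /eqP; rewrite (negbTE N1z0).
pose Y : {poly C} := 'X - z0%:P.
have Yz z : Y.[z] = z - z0 by rewrite /Y !hornerE.
have Y' : Y^`() = 1 by rewrite /Y derivB derivX derivC subr0.
rewrite -/Y in NE; clearbody Y.
(* [P1 / (Y * Q1)] is [f'' / f'] after cancelling [Y ^+ n]: a simple pole at [z0] with residue
   [m]. *)
pose Q1 := N1 * q.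
pose P1 := (N1^`() * Y + m%:R%:P * N1) * q - 2%:P * (Y * N1 * q^`()).
have TE (A B : {poly C}) z : (wronskian A (Y * B) - (2^-1)%:P * A ^+ 2).[z] =
    A^`().[z] * ((z - z0) * B.[z]) - A.[z] * (B.[z] + (z - z0) * B^`().[z]) -
    2^-1 * A.[z] ^+ 2.
  rewrite /wronskian derivM Y' mul1r.
  by rewrite !(horner_exp, hornerD, hornerN, hornerM, hornerC) Yz.
exists (wronskian P1 (Y * Q1) - (2^-1)%:P * P1 ^+ 2), (Q1 ^+ 2).
have Q1z0 : Q1.[z0] != 0 by rewrite /Q1 hornerM mulf_neq0.
have P1z0 : P1.[z0] = m%:R * Q1.[z0].
  rewrite /P1 /Q1 !(hornerD, hornerN, hornerM, hornerC) Yz subrr; ring.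
split.
- by rewrite horner_exp expf_neq0.
(* Only [- P1 * Q1 - P1 ^+ 2 / 2] survives at [z0]. *)
- rewrite TE horner_exp subrr P1z0.
  rewrite [X in modulus X](_ : _ = - (m%:R + m%:R ^+ 2 / 2)); last by field.
  rewrite /modulus normcN -/(modulus _).
  rewrite (_ : _ + _ = (m%:R + m%:R ^+ 2 / 2 : R)%:C); last first.
    by rewrite !(rmorphD, rmorphM, fmorphV, rmorphXn, rmorph_nat).
  rewrite modulus_real ger0_norm; last by rewrite addr_ge0 ?divr_ge0 ?sqr_ge0.
  have m1 : 1 <= m%:R :> R by rewrite mE ler1n.
  have m2 : 1 <= m%:R ^+ 2 :> R by rewrite expr_ge1.
  lra.
- move=> z; have [Qz|Qz] := eqVneq (N * q).[z] 0.
    rewrite (_ : _ / _ = 0); first by rewrite /modulus ComplexField.Normc.normc0 modulus_ge0.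
    apply/eqP; rewrite mulf_eq0 invr_eq0; apply/orP; right.
    rewrite horner_exp -exprMn expf_eq0/= -Yz mulrC -hornerM.
    move: Qz; rewrite NE mE exprS !hornerM horner_exp => /eqP.
    rewrite !mulf_eq0 expf_eq0/= => /orP[/orP[->|/orP[->|/andP[_ ->]]]|->] //;
      by rewrite ?orbT.
  have nz (w : C) : (N * q).[w] != 0 ->
      [/\ N1.[w] != 0, q.[w] != 0 & w - z0 != 0].
    rewrite NE mE hornerM mulf_eq0 negb_or hornerM mulf_eq0 negb_or horner_exp.
    by rewrite expf_eq0/= -/Y Yz -andbA => /and3P[].
  rewrite (@schwarzian_pre_rational _ P1 (Y * Q1)).
  + rewrite le_eqVlt; apply/orP; left; apply/eqP; congr modulus.
    rewrite TE horner_exp (hornerM Y) Yz exprMn (mulrC (_ ^+ 2)); congr (_ / _).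
    by rewrite -TE hornerD hornerN; congr (_ - _); rewrite hornerM hornerC horner_exp.
  + by have [? ? ?] := nz z Qz; rewrite !hornerM Yz !mulf_neq0.
  + apply: filterS (near_horner_neq0 Qz) => w Qw.
    have [N1w qw wz0] := nz w Qw.
    rewrite (pre_schwarzian_rational fE)// -/N.
    have -> : N^`() = Y ^+ n * (N1^`() * Y + m%:R%:P * N1).
      rewrite NE -/Y derivM deriv_exp Y' mE/= exprS mul1r -mulr_natl polyC_natr; ring.
    rewrite NE /P1 /Q1 mE exprS.
    rewrite !(horner_exp, hornerD, hornerN, hornerM, hornerC) Yz.
    by field; rewrite N1w qw wz0 expf_neq0.
Qed.

End rational_schwarzian.

(** * Automorphisms of the disk *)

Section planar_integrals.
Context {R : realType}.
Local Notation C := R[i].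
Local Notation mu2 := ((@lebesgue_measure R) \x (@lebesgue_measure R))%E.
Local Notation D := (@planar_disk R).
Implicit Types F : C -> R.

Definition pt (p : R * R) : C := p.1 +i* p.2.

Lemma planar_diskE p : planar_disk p <-> p.1 ^+ 2 + p.2 ^+ 2 < 1 :> R.
Proof. by case: p => x y; exact: unit_diskE. Qed.

Lemma unit_disk_modulus (z : C) : unit_disk z <-> modulus z < 1.
Proof. by rewrite /unit_disk/= normC_modulus ltcR. Qed.

Lemma ge0_integral_disk_rotation F (u : C) : modulus u = 1 ->
    measurable_fun D (F \o pt) -> (forall z, unit_disk z -> 0 <= F z) ->
  (\int[mu2]_(p in D) (F (u * pt p))%:E = \int[mu2]_(p in D) (F (pt p))%:E)%E.
Proof.
move=> u1 mF F0; rewrite integral_mkcond [RHS]integral_mkcond.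
have cs : Re u ^+ 2 + Im u ^+ 2 = 1 by rewrite -modulus_sqr u1 expr1n.
rewrite -[RHS](@ge0_integral_rotation R _ (Re u) (Im u))//.
- apply: eq_integral => p _; rewrite /patch.
  pose q : R * R := (Re u * p.1 - Im u * p.2, Im u * p.1 + Re u * p.2).
  rewrite -/q; have qE : pt q = u * pt p.
    by case: (u) @q => a b q; apply/eqP; rewrite eq_complex/= eqxx addrC eqxx.
  have -> : (q \in D) = (p \in D).
    have H : planar_disk q <-> planar_disk p.
      by rewrite -[planar_disk q]/(unit_disk (pt q)) -[planar_disk p]/(unit_disk (pt p)) qE !unit_disk_modulus modulusM u1 mul1r.
    by apply/idP/idP; rewrite !inE => /H.
  by rewrite qE.
- apply: (measurable_restrictT _ measurable_planar_disk).1.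
  exact/measurable_EFinP.
- by move=> p; rewrite /patch; case: ifPn => // /set_mem /F0 Fp; rewrite lee_fin.
Qed.

(** For [0 < a < 1] this is the inverse of [sigma a], which is [tau (- a)]. *)
Definition tau (a : R) (z : C) : C := (z - a%:C) / (1 - a%:C * z).
(** For [|a| < 1] this is the modulus of the derivative of [tau a]; areas scale by its square. *)
Definition jac (a : R) (z : C) : R := (1 - a ^+ 2) / modulus (1 - a%:C * z) ^+ 2.

Lemma ge0_integral_disk_tau F (a : R) : 0 < a < 1 ->
    measurable_fun D (F \o pt) -> (forall z, unit_disk z -> 0 <= F z) ->
  (\int[mu2]_(p in D) (F (tau a (pt p)) * jac a (pt p) ^+ 2)%:E =
   \int[mu2]_(p in D) (F (pt p))%:E)%E.
Proof.
move=> a01 mF F0; rewrite integral_mkcond [RHS]integral_mkcond.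
have /andP[a0 a1] := a01; have an0 : a != 0 by rewrite gt_eqF.
rewrite -[RHS](@ge0_integral_disk_automorphism R _ a)//.
- apply: eq_integral => -[x y] _; rewrite /patch /=.
  set n := (a^-1 - x) ^+ 2 + y ^+ 2; set k := (1 - a ^+ 2) / a ^+ 2.
  have k0 : 0 < k by rewrite divr_gt0 ?exprn_gt0// subr_gt0 expr_lt1// ltW.
  have n0 : 0 <= n by rewrite addr_ge0 ?sqr_ge0.
  (* [n] vanishes only at the pole [a^-1], outside the disk; its junk image [- a^-1] lies outside as
     well. *)
  have [nz|nn0] := eqVneq n 0.
    rewrite nz invr0 !mulr0 sub0r.
    have : ((- a^-1, 0) \in D) = false.
      apply/negbTE; rewrite notin_setE => /planar_diskE/=.
      by rewrite expr0n/= addr0 sqrrN ltNge expr_ge1 ?invr_ge0 ?(ltW a0)// invf_ge1// ltW.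
    move=> ->; rewrite mul0e; case: ifPn => // /set_mem /planar_diskE/= xy.
    move/eqP: nz; rewrite paddr_eq0 ?sqr_ge0// => /andP[].
    rewrite !sqrf_eq0 subr_eq0 => /eqP xa /eqP y0; move: xy.
    by rewrite -xa y0 expr0n addr0 ltNge expr_ge1 ?invr_ge0 ?(ltW a0)// invf_ge1// ltW.
  have ngt0 : 0 < n by rewrite lt_neqAle eq_sym nn0.
  have kE : k = a^-1 ^+ 2 - 1 by rewrite /k; field.
  have key : 1 - ((k * ((a^-1 - x) / n) - a^-1) ^+ 2 + (k * (y / n)) ^+ 2) =
      (k / n) * (1 - (x ^+ 2 + y ^+ 2)).
    rewrite kE; move: nn0; rewrite /n; move: a^-1 => i nn0; field.
    exact: nn0.
  pose q : R * R := (k * ((a^-1 - x) / n) - a^-1, k * (y / n)).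
  rewrite -/q; have qD : (q \in D) = ((x, y) \in D).
    have E : 1 - (q.1 ^+ 2 + q.2 ^+ 2) = (k / n) * (1 - (x ^+ 2 + y ^+ 2)).
      exact: key.
    have H : planar_disk q <-> planar_disk (x, y).
      rewrite !planar_diskE.
      have -> : (q.1 ^+ 2 + q.2 ^+ 2 < 1) = ((x, y).1 ^+ 2 + (x, y).2 ^+ 2 < 1).
        by rewrite -subr_gt0 E (pmulr_rgt0 _ (divr_gt0 k0 ngt0)) subr_gt0.
      by [].
    by apply/idP/idP; rewrite !inE => /H.
  rewrite qD; case: ifPn => [xyD|]; last by rewrite mul0e.
  have mE : modulus (1 - a%:C * (x +i* y)) ^+ 2 = a ^+ 2 * n.
    by rewrite modulus_sqr /= /n; field.
  have jE : jac a (x +i* y) = k / n.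
    by rewrite /jac mE /k; field; rewrite an0 nn0.
  have den0 : 1 - a%:C * (x +i* y) != 0.
    apply: contra_neq nn0 => d0; apply/eqP.
    by rewrite -(mulrI_eq0 _ (lregP (expf_neq0 2 an0))) -mE d0 /modulus
      ComplexField.Normc.normc0 expr0n.
  rewrite -EFinM jE; congr (F _ * _)%:E.
  rewrite /tau; apply: (mulIf den0); rewrite divfK//.
  apply/eqP; rewrite eq_complex/=; move: nn0; rewrite kE /n => nn0'.
  have nn1 : (1 + - x * a) ^+ 2 + (y * a) ^+ 2 != 0.
    rewrite (_ : _ + _ = a ^+ 2 * ((a^-1 - x) ^+ 2 + y ^+ 2)); last by field.
    by rewrite mulf_neq0 ?expf_neq0.
  by apply/andP; split; apply/eqP; field; rewrite an0 nn1.
- apply: (measurable_restrictT _ measurable_planar_disk).1.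
  exact/measurable_EFinP.
- by move=> p; rewrite /patch; case: ifPn => // /set_mem /F0 Fp; rewrite lee_fin.
- move=> x y xy; rewrite /patch; case: ifPn => // /set_mem/planar_diskE/=.
  by rewrite ltNge xy.
Qed.

End planar_integrals.

Section derivable_moebius.
Context {K : numFieldType}.
Implicit Types (c k z : K) (f g : K -> K).

Lemma derivable_mul1 f g z :
  derivable f z 1 -> derivable g z 1 -> derivable (fun w => f w * g w) z 1.
Proof. by move=> df dg; exact: (derivableM df dg). Qed.

Lemma derivable_affine c z : derivable (fun w => 1 - c * w) z 1.
Proof.
apply: derivableB; first exact: derivable_cst.
by apply: derivable_mul1; [exact: derivable_cst|exact: derivable_id].
Qed.

Lemma derivable_inv_affine c k z : 1 - c * z != 0 ->
  derivable (fun w => k / (1 - c * w)) z 1.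
Proof.
move=> d0; apply: derivable_mul1; first exact: derivable_cst.
have d : derivable (fun w => 1 - c * w) z 1 by exact: derivable_affine.
exact: derivableV.
Qed.

Lemma derivable_moebius c z : 1 - c * z != 0 ->
  derivable (fun w => (w - c) / (1 - c * w)) z 1.
Proof.
move=> d0; apply: derivable_mul1.
  by apply: derivableB; [exact: derivable_id|exact: derivable_cst].
under eq_fun do rewrite -[_^-1]mul1r; exact: derivable_inv_affine.
Qed.

End derivable_moebius.

Section disk_automorphism.
Context {R : realType}.
Local Notation C := R[i].
Local Notation mu2 := ((@lebesgue_measure R) \x (@lebesgue_measure R))%E.
Local Notation D := (@planar_disk R).
Implicit Types (a b : R) (z w : C) (G : C -> R) (phi : C -> C).

Lemma Re_den_gt0 a z : `|a| < 1 -> modulus z < 1 -> 0 < Re (1 - a%:C * z).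
Proof.
case: z => x y a1 z1; rewrite /= mul0r subr0 subr_gt0.
have x1 : `|x| < 1 by exact: le_lt_trans (norm_Re_le (x +i* y)) z1.
by rewrite (le_lt_trans (ler_norm _))// normrM mulr_ilt1.
Qed.

Lemma den_neq0 a z : `|a| < 1 -> modulus z < 1 -> 1 - a%:C * z != 0.
Proof.
by move=> a1 z1; have := Re_den_gt0 a1 z1; apply: contraTneq => ->; rewrite ltxx.
Qed.

Lemma add1_neq0 z : modulus z < 1 -> 1 + z != 0.
Proof.
rewrite addr_eq0 -ltcR -normC_modulus; apply: contraTneq => w1.
by rewrite -(normrN z) -w1 normr1 ltxx.
Qed.

Lemma sub1_neq0 z : modulus z < 1 -> 1 - z != 0.
Proof.
by rewrite subr_eq0 -ltcR -normC_modulus; apply: contraTneq => <-; rewrite normr1 ltxx.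
Qed.

Lemma modulus_gt0 z : z != 0 -> 0 < modulus z.
Proof. by move=> z0; rewrite -ltcR -normC_modulus normr_gt0. Qed.

Lemma jac_gt0 a z : `|a| < 1 -> modulus z < 1 -> 0 < jac a z.
Proof.
move=> a1 z1; rewrite divr_gt0 ?exprn_gt0 ?modulus_gt0 ?den_neq0//.
by rewrite subr_gt0 -real_normK ?num_real// expr_lt1.
Qed.

(** The Schwarz-Pick identity, the equality case for automorphisms. It converts the Bergman weight
    into powers of [jac]. *)
Lemma one_sub_tau a z : `|a| < 1 -> modulus z < 1 ->
  1 - modulus (tau a z) ^+ 2 = jac a z * (1 - modulus z ^+ 2).
Proof.
move=> a1 z1; have := modulus_gt0 (den_neq0 a1 z1); rewrite /jac /tau modulusM modulusV.
set m := modulus (1 - _) => m0.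
have m0' : m != 0 by rewrite gt_eqF.
have mE : m ^+ 2 = modulus (z - a%:C) ^+ 2 + (1 - a ^+ 2) * (1 - modulus z ^+ 2).
  by rewrite /m !modulus_sqr; case: (z) => x y /=; ring.
apply: (mulIf (expf_neq0 2 m0')); rewrite mulrBl mul1r exprMn exprVn.
rewrite (divfK (expf_neq0 2 m0')) mulrAC divfK ?expf_neq0// mE; ring.
Qed.

Lemma tau_disk a z : `|a| < 1 -> modulus z < 1 -> modulus (tau a z) < 1.
Proof.
move=> a1 z1; rewrite -(expr_lt1 (n := 2))// ?modulus_ge0// -subr_gt0 one_sub_tau//.
by rewrite mulr_gt0 ?jac_gt0// subr_gt0 expr_lt1// modulus_ge0.
Qed.

Lemma tauK a z : `|a| < 1 -> modulus z < 1 -> tau (- a) (tau a z) = z.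
Proof.
move=> a1 z1; have d1 := den_neq0 a1 z1.
have d2 : (1 - a ^+ 2)%:C != 0.
  rewrite fmorph_eq0 gt_eqF// subr_gt0.
  by rewrite -real_normK ?num_real// expr_lt1.
rewrite /tau !rmorphN/= !opprK mulNr opprK; move: d2; rewrite rmorphB rmorph1 rmorphXn/=.
move: (a%:C) d1 => c d1 d2; field; rewrite d1/=.
rewrite (_ : _ + _ = 1 - c ^+ 2)//; ring.
Qed.

(** The chain rule for [tau (- a) \o tau a], obtained without derivatives by using [one_sub_tau] in
    both directions. *)
Lemma jacK a z : `|a| < 1 -> modulus z < 1 -> jac (- a) (tau a z) * jac a z = 1.
Proof.
move=> a1 z1; have a1' : `|- a| < 1 by rewrite normrN.
have p : 0 < 1 - modulus z ^+ 2 by rewrite subr_gt0 expr_lt1// modulus_ge0.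
have := one_sub_tau a1' (tau_disk a1 z1); rewrite tauK// one_sub_tau// mulrA.
by rewrite -{1}(mul1r (1 - _)) => /mulIf <-//; rewrite gt_eqF.
Qed.

Lemma derivable_tau a z : `|a| < 1 -> modulus z < 1 -> derivable (tau a) z 1.
Proof. by move=> a1 z1; apply: derivable_moebius; exact: den_neq0. Qed.

(** The Bergman integrand, with a real function in place of the modulus of an analytic one so that
    it also accepts the comparison functions below. *)
Definition weight (b : R) (G : C -> R) (z : C) : R :=
  G z ^+ 2 * (1 - modulus z ^+ 2) `^ b / pi.

Lemma weight_ge0 b G z : 0 <= weight b G z.
Proof. by rewrite /weight divr_ge0 ?pi_ge0// mulr_ge0 ?sqr_ge0 ?powR_ge0. Qed.

Lemma measurable_modulus_pt : measurable_fun D (@modulus R \o pt).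
Proof.
apply: (@measurable_modulus_analytic R id) => z _; exact: derivable_id.
Qed.

Lemma measurable_weight b G : measurable_fun D (G \o pt) ->
  measurable_fun D (weight b G \o pt).
Proof.
move=> mG; apply: measurable_funM; last exact: measurable_cst.
apply: measurable_funM; first exact: measurable_funX.
apply: (measurableT_comp (measurable_powR b)).
apply: measurable_funB; first exact: measurable_cst.
exact: measurable_funX measurable_modulus_pt.
Qed.

(* [psi0] is the image of [phi] under the isometry of the Bergman space induced
   by [tau]: [phi (tau z) * tau' (z) `^ ((alpha + 2) / 2)], where
   [tau' (z) = (Num.sqrt (1 - a ^+ 2) / (1 - a * z)) ^+ 2]. *)
Definition psi0 a (alpha : R) phi (z : C) : C :=
  phi (tau a z) * cpow (alpha + 2) ((Num.sqrt (1 - a ^+ 2))%:C / (1 - a%:C * z)).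

Lemma Re_inv_gt0 (k : R) z : 0 < k -> 0 < Re z -> 0 < Re (k%:C / z).
Proof.
case: z => x y k0 /= x0; rewrite mul0r subr0 mulr_gt0// divr_gt0//.
by rewrite ltr_pwDl ?sqr_ge0// exprn_gt0.
Qed.

Lemma sqrt_gt0 a : `|a| < 1 -> 0 < Num.sqrt (1 - a ^+ 2).
Proof.
by move=> a1; rewrite sqrtr_gt0 subr_gt0 -real_normK ?num_real// expr_lt1.
Qed.

Lemma analytic_psi0 a alpha phi : `|a| < 1 -> analytic_on (@unit_disk R) phi ->
  analytic_on (@unit_disk R) (psi0 a alpha phi).
Proof.
move=> a1 aphi z /unit_disk_modulus z1; apply: derivable_mul1.
  apply: (@derivable_comp1 _ phi (tau a)); first exact: derivable_tau.
  by apply: aphi; apply/unit_disk_modulus; exact: tau_disk.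
apply: (@derivable_comp1 _ (cpow (alpha + 2))
  (fun z => (Num.sqrt (1 - a ^+ 2))%:C / (1 - a%:C * z))).
  by apply: derivable_inv_affine; exact: den_neq0.
by apply: derivable_cpow; apply: Re_inv_gt0; [exact: sqrt_gt0|exact: Re_den_gt0].
Qed.

Lemma modulus_psi0 a alpha phi z : `|a| < 1 -> modulus z < 1 ->
  modulus (psi0 a alpha phi z) ^+ 2 =
    modulus (phi (tau a z)) ^+ 2 * jac a z `^ (alpha + 2).
Proof.
move=> a1 z1; rewrite /psi0 modulusM exprMn; congr (_ * _).
rewrite modulus_cpow; last by apply: Re_inv_gt0; [exact: sqrt_gt0|exact: Re_den_gt0].
rewrite modulusM modulusV modulus_real ger0_norm ?sqrtr_ge0//.
have m0 : 0 <= Num.sqrt (1 - a ^+ 2) / modulus (1 - a%:C * z).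
  by rewrite divr_ge0 ?modulus_ge0 ?sqrtr_ge0.
rewrite expr2 -powRM// -expr2; congr (_ `^ _); rewrite expr_div_n sqr_sqrtr// subr_ge0.
by rewrite -real_normK ?num_real// expr_le1// ltW.
Qed.

(** Raising the weight exponent by [2 * m] is compensated by the factor [jac ^+ m] on the
    multiplier. The case [m = 0] gives the isometry; [m = 2] gives the transformation rule of the
    Schwarzian, from [alpha] to [alpha + 4]. *)
Lemma weight_psi0 a alpha (m : nat) phi G z : `|a| < 1 -> modulus z < 1 ->
  weight (alpha + (2 * m)%:R) (fun v => G v * modulus (psi0 a alpha phi v)) z =
  weight (alpha + (2 * m)%:R)
    (fun w => G (tau (- a) w) * jac (- a) w ^+ m * modulus (phi w)) (tau a z) *
  jac a z ^+ 2.
Proof.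
move=> a1 z1; rewrite /weight tauK// one_sub_tau//.
have j0 := jac_gt0 a1 z1; set J := jac a z in j0 *.
have -> : jac (- a) (tau a z) = J^-1.
  by apply: (mulIf (lt0r_neq0 j0)); rewrite jacK// mulVf// gt_eqF.
rewrite [in LHS]exprMn modulus_psi0// -/J; clearbody J.
rewrite powRM ?(ltW j0)//; last by rewrite subr_ge0 expr_le1 ?modulus_ge0// ltW.
have -> : J `^ (alpha + (2 * m)%:R) = J `^ (alpha + 2) * (J ^+ m) ^+ 2 / J ^+ 2.
  have Jn0 : J != 0 by rewrite gt_eqF.
  rewrite !(powRD (x := J)) ?Jn0 ?implybT// !powR_mulrn ?(ltW j0)// mulnC exprM.
  by rewrite powRr1 ?(ltW j0)//; field.
rewrite exprVn; have pi0 : pi != 0 :> R by rewrite gt_eqF// pi_gt0.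
move: (@pi R) pi0 => P pi0; field.
by rewrite pi0 expf_neq0 ?gt_eqF.
Qed.

End disk_automorphism.

Section nonneg_integral.
Local Open Scope ereal_scope.
Context d (T : measurableType d) (R : realType) (mu : {measure set T -> \bar R}).

(* Contrary to [ge0_le_integral], no measurability is required. *)
Lemma ge0_le_integral_nomeas (D : set T) (f g : T -> \bar R) :
  (forall x, D x -> 0 <= f x) -> (forall x, D x -> f x <= g x) ->
  \int[mu]_(x in D) f x <= \int[mu]_(x in D) g x.
Proof.
move=> f0 fg; rewrite integral_mkcond [leRHS]integral_mkcond.
have h x : 0 <= (f \_ D) x /\ (f \_ D) x <= (g \_ D) x.
  by rewrite /patch; case: ifPn => // /set_mem Dx; split; [exact: f0|exact: fg].
rewrite !ge0_integralTE//; last 2 first.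
- by move=> x; have [? ?] := h x; exact: le_trans (_ : 0 <= (f \_ D) x) _.
- by move=> x; have [] := h x.
apply: ge_ereal_sup => _ [k kf <-]; apply: ereal_sup_ubound; exists k => // x.
by apply: le_trans (kf x) _; have [] := h x.
Qed.

End nonneg_integral.

Section bergman_transport.
Context {R : realType}.
Local Notation C := R[i].
Local Notation mu2 := ((@lebesgue_measure R) \x (@lebesgue_measure R))%E.
Local Notation D := (@planar_disk R).
Implicit Types (a b alpha : R) (G : C -> R) (phi : C -> C).

Lemma bergman_normsqE b phi : bergman_normsq b phi =
  ((b + 1)%:E * \int[mu2]_(p in D) (weight b (fun z => modulus (phi z)) (pt p))%:E)%E.
Proof. by []. Qed.

Lemma integral_weight_rotation b G (u : C) : modulus u = 1 ->
    measurable_fun D (G \o pt) ->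
  (\int[mu2]_(p in D) (weight b (fun z => G (u * z)%R) (pt p))%:E =
   \int[mu2]_(p in D) (weight b G (pt p))%:E)%E.
Proof.
move=> u1 mG.
rewrite -(@ge0_integral_disk_rotation R (weight b G) u)//.
- by apply: eq_integral => p _; rewrite /weight modulusM u1 mul1r.
- exact: measurable_weight.
- by move=> z _; exact: weight_ge0.
Qed.

Lemma integral_weight_psi0 a alpha (m : nat) phi G : 0 < a < 1 ->
    let H w := G (tau (- a) w) * jac (- a) w ^+ m * modulus (phi w) in
    measurable_fun D (H \o pt) ->
  (\int[mu2]_(p in D)
     (weight (alpha + (2 * m)%:R) (fun v => G v * modulus (psi0 a alpha phi v))%R (pt p))%:E =
   \int[mu2]_(p in D) (weight (alpha + (2 * m)%:R) H (pt p))%:E)%E.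
Proof.
move=> a01 H mH; have a1 : `|a| < 1 by case/andP: a01 => a0 a1; rewrite gtr0_norm.
rewrite -(@ge0_integral_disk_tau R (weight (alpha + (2 * m)%:R) H) a)//.
- apply: eq_integral => p /set_mem /unit_disk_modulus p1.
  by rewrite weight_psi0.
- exact: measurable_weight.
- by move=> z _; exact: weight_ge0.
Qed.

Lemma bergman_normsq_psi a alpha phi (u : C) : 0 < a < 1 -> modulus u = 1 ->
    analytic_on (@unit_disk R) phi ->
  bergman_normsq alpha (fun z => psi0 a alpha phi (u * z)) = bergman_normsq alpha phi.
Proof.
move=> a01 u1 aphi; have a1 : `|a| < 1 by case/andP: a01 => a0 a1; rewrite gtr0_norm.
rewrite !bergman_normsqE; congr (_ * _)%E.
rewrite (integral_weight_rotation _ (G := fun z => modulus (psi0 a alpha phi z)) u1); last first.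
  by apply: measurable_modulus_analytic; exact: analytic_psi0.
have E := @integral_weight_psi0 a alpha 0 phi (fun=> 1) a01.
rewrite muln0 addr0 in E; have HE : (fun w : C => 1 * jac (- a) w ^+ 0 * modulus (phi w)) =
    (fun w => modulus (phi w)) by apply/funext => w; rewrite expr0 !mul1r.
have HE' : (fun v => 1 * modulus (psi0 a alpha phi v)) =
    (fun v => modulus (psi0 a alpha phi v)) by apply/funext => w; rewrite mul1r.
by rewrite HE HE' in E; apply: E; exact: measurable_modulus_analytic.
Qed.

End bergman_transport.

(** * Blow-up at the critical point *)

Section moebius_limit.
Context {K : numFieldType}.
Implicit Types (a : nat -> K) (w z : K).

Lemma cvg_den a w : a n @[n --> \oo] --> (1 : K) ->
  1 + a n * w @[n --> \oo] --> 1 + w.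
Proof.
move=> ca; have : 1 + a n * w @[n --> \oo] --> 1 + 1 * w; last by rewrite mul1r.
by apply: cvgD; [exact: cvg_cst|apply: cvgM => //; exact: cvg_cst].
Qed.

(** The automorphisms contract the whole disk to the boundary point [z], since
    [(w + 1) / (1 + w) = 1]. *)
Lemma cvg_moebius a w z : 1 + w != 0 -> a n @[n --> \oo] --> (1 : K) ->
  z * ((w + a n) / (1 + a n * w)) @[n --> \oo] --> z.
Proof.
move=> w0 ca.
have : z * ((w + a n) / (1 + a n * w)) @[n --> \oo] --> z * ((w + 1) / (1 + w)).
  apply: cvgM; first exact: cvg_cst.
  apply: cvgM; first by apply: cvgD => //; exact: cvg_cst.
  by apply: cvgV => //; exact: cvg_den.
by rewrite [w + 1]addrC divff// mulr1.
Qed.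

End moebius_limit.

Section blow_up.
Context {R : realType}.
Local Notation C := R[i].
Local Notation mu2 := ((@lebesgue_measure R) \x (@lebesgue_measure R))%E.
Local Notation D := (@planar_disk R).
Variables (T V : {poly C}) (z0 : C).
Hypotheses (z01 : modulus z0 = 1) (Vz0 : V.[z0] != 0).

Definition pole_modulus (z : C) : R := modulus (T.[z] / (V.[z] * (z - z0) ^+ 2)).

(** The modulus of [(g \o rho) * rho' ^+ 2] for [rho = z0 * tau (- a)], where [g] is the comparison
    function with modulus [pole_modulus]. *)
Definition blow_up (a : R) (w : C) : R :=
  pole_modulus (z0 * tau (- a) w) * jac (- a) w ^+ 2.

Lemma analytic_horner_tau (P : {poly C}) (a : R) : `|a| < 1 ->
  analytic_on (@unit_disk R) (fun w => P.[z0 * tau a w]).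
Proof.
move=> a1 w /unit_disk_modulus w1.
apply: (@derivable_comp1 _ (horner P) (fun w => z0 * tau a w)).
  by apply: derivable_mul1; [exact: derivable_cst|exact: derivable_tau].
by have [] := is_derive_horner P (z0 * tau a w).
Qed.

Lemma measurable_pole (a : R) : `|a| < 1 ->
  measurable_fun D ((fun w => pole_modulus (z0 * tau a w)) \o pt).
Proof.
move=> a1; pose P := V * ('X - z0%:P) ^+ 2.
rewrite (_ : _ \o _ = (fun p => modulus T.[z0 * tau a (pt p)] *
    (modulus P.[z0 * tau a (pt p)])^-1)); last first.
  apply/funext => p; rewrite /= /pole_modulus modulusM modulusV /P.
  by rewrite hornerM horner_exp hornerXsubC.
apply: measurable_funM.
  apply: (@measurable_modulus_analytic R (fun w => T.[z0 * tau a w])).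
  exact: analytic_horner_tau.
apply: (measurableT_comp measurable_invr).
apply: (@measurable_modulus_analytic R (fun w => P.[z0 * tau a w])).
exact: analytic_horner_tau.
Qed.

Lemma measurable_jac (a : R) : `|a| < 1 -> measurable_fun D (jac a \o pt).
Proof.
move=> a1; apply: measurable_funM; first exact: measurable_cst.
apply: (measurableT_comp measurable_invr); apply: measurable_funX.
apply: (@measurable_modulus_analytic R (fun z => 1 - a%:C * z)) => z _.
by apply: derivable_affine.
Qed.

Lemma measurable_blow_up (a : R) (phi : C -> C) : `|a| < 1 ->
    analytic_on (@unit_disk R) phi ->
  measurable_fun D ((fun w => blow_up a w * modulus (phi w)) \o pt).
Proof.
move=> a1 aphi; have a1' : `|- a| < 1 by rewrite normrN.
apply: measurable_funM; last exact: measurable_modulus_analytic.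
apply: measurable_funM; first exact: measurable_pole.
by apply: measurable_funX; exact: measurable_jac.
Qed.

(** The point [z0 * tau (- a) w] is at distance [(1 - a) * |1 - w| / |1 + a * w|] from [z0]. The
    double pole thus contributes [(1 - a) ^- 2], which cancels against [(1 - a ^+ 2) ^+ 2] in
    [jac ^+ 2] and leaves a finite limit. *)
Lemma blow_upE (a : R) (w : C) : 0 < a < 1 -> modulus w < 1 ->
  blow_up a w = modulus T.[z0 * tau (- a) w] * (modulus V.[z0 * tau (- a) w])^-1 *
    ((1 + a) ^+ 2 / (modulus (1 + a%:C * w) ^+ 2 * modulus (1 - w) ^+ 2)).
Proof.
move=> /andP[a0 a1] w1.
have an : `|- a| < 1 by rewrite normrN gtr0_norm.
have := den_neq0 an w1; rewrite rmorphN/= mulNr opprK => d0.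
have w0 : 1 - w != 0 by exact: sub1_neq0.
have tE : z0 * tau (- a) w - z0 = - z0 * ((1 - a)%:C * (1 - w) / (1 + a%:C * w)).
  rewrite /tau rmorphN/= mulNr !opprK rmorphB rmorph1/=.
  by move: (a%:C) d0 => c d0; field.
have md : modulus (1 + a%:C * w) != 0 by rewrite gt_eqF// modulus_gt0.
have mw : modulus (1 - w) != 0 by rewrite gt_eqF// modulus_gt0.
have a0' : 1 - a != 0 by rewrite subr_eq0 gt_eqF.
have mE : modulus (z0 * tau (- a) w - z0) =
    (1 - a) * modulus (1 - w) / modulus (1 + a%:C * w).
  rewrite tE !modulusM modulusV modulus_real /modulus normcN -!/(modulus _) z01 mul1r.
  by rewrite ger0_norm// subr_ge0 ltW.
rewrite /blow_up /pole_modulus /jac modulusM modulusV modulusM.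
rewrite [modulus (_ ^+ 2)]modulusM mE rmorphN/= mulNr opprK sqrrN invfM.
move: (modulus T.[_]) (modulus V.[_])^-1 => t v.
by field; rewrite md mw a0'.
Qed.

Lemma blow_up_cvg (a : nat -> R) (w : C) : (forall n, 0 < a n < 1) ->
    a n @[n --> \oo] --> (1 : R) -> modulus w < 1 ->
  blow_up (a n) w @[n --> \oo] -->
    modulus (T.[z0] / V.[z0]) * (4 / (modulus (1 + w) ^+ 2 * modulus (1 - w) ^+ 2)).
Proof.
move=> a01 acvg w1.
have den1 := add1_neq0 w1.
have den2 := sub1_neq0 w1.
have ca : (a n)%:C @[n --> \oo] --> (1 : C).
  exact: (cvg_comp _ _ acvg (@continuous_real_complex R 1)).
have cd : 1 + (a n)%:C * w @[n --> \oo] --> 1 + w.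
  exact: cvg_den.
have ct : z0 * tau (- a n) w @[n --> \oo] --> z0.
  have E : (fun n => z0 * tau (- a n) w) = (fun n => z0 * ((w + (a n)%:C) / (1 + (a n)%:C * w))).
    by apply/funext => n; rewrite /tau rmorphN/= mulNr !opprK.
  rewrite E; exact: (@cvg_moebius _ (fun n => (a n)%:C) w z0 den1 ca).
have cT : modulus T.[z0 * tau (- a n) w] @[n --> \oo] --> modulus T.[z0].
  exact: (cvg_comp _ _ (cvg_comp _ _ ct (@continuous_hornerC _ T z0)) (@continuous_modulus R _)).
have cV : modulus V.[z0 * tau (- a n) w] @[n --> \oo] --> modulus V.[z0].
  exact: (cvg_comp _ _ (cvg_comp _ _ ct (@continuous_hornerC _ V z0)) (@continuous_modulus R _)).
have cm : modulus (1 + (a n)%:C * w) @[n --> \oo] --> modulus (1 + w).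
  exact: (cvg_comp _ _ cd (@continuous_modulus R _)).
under eq_fun do rewrite blow_upE//.
rewrite modulusM modulusV; apply: cvgM.
  by apply: cvgM => //; apply: cvgV => //; rewrite gt_eqF// modulus_gt0.
have -> : 4 = (1 + 1) ^+ 2 :> R by ring.
apply: cvgM.
  by apply: cvgM; apply: cvgD => //; exact: cvg_cst.
apply: cvgV; first by rewrite mulf_neq0// expf_neq0// gt_eqF// modulus_gt0.
by apply: cvgM; [apply: cvgM|exact: cvg_cst].
Qed.

End blow_up.

Section koebe_comparison.
Context {R : realType}.
Local Notation C := R[i].
Local Notation mu2 := ((@lebesgue_measure R) \x (@lebesgue_measure R))%E.
Local Notation D := (@planar_disk R).

Lemma limn_einf_le (u : (\bar R)^nat) t : (forall n, u n <= t)%E -> (limn_einf u <= t)%E.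
Proof.
move=> ut; rewrite limn_einf_lim; apply: lime_le; first exact: is_cvg_einfs.
apply: nearW => n; apply: le_trans (ut n); apply: ereal_inf_lbound.
by exists n => /=.
Qed.

Lemma koebe_weight_le (T V : {poly C}) (z0 : C) (b : R) (phi : C -> C) (t : \bar R) :
    modulus z0 = 1 -> V.[z0] != 0 -> 3 / 2 <= modulus (T.[z0] / V.[z0]) ->
    analytic_on (@unit_disk R) phi ->
    (forall a : R, (0 < a < 1)%R ->
      \int[mu2]_(p in D) (weight b (fun w => blow_up T V z0 a w * modulus (phi w))%R
        (pt p))%:E <= t)%E ->
  (\int[mu2]_(p in D)
    (weight b (fun w => modulus (schwarzian (@koebe R) w * phi w)) (pt p))%:E <= t)%E.
Proof.
move=> z01 Vz0 c32 aphi ft.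
(* Since [harmonic 0 = 1], halving keeps [a 0] positive. *)
pose a n : R := 1 - harmonic n / 2.
have a01 n : 0 < a n < 1.
  have h0 : 0 < harmonic n :> R by rewrite invr_gt0.
  have h1 : harmonic n <= 1 :> R by rewrite invf_le1// ler1n.
  by rewrite /a; apply/andP; split; lra.
have acvg : a n @[n --> \oo] --> (1 : R).
  have : a n @[n --> \oo] --> (1 - 0 / 2 : R); last by rewrite mul0r subr0.
  apply: cvgB; first exact: cvg_cst.
  by apply: cvgM; [exact: cvg_harmonic|exact: cvg_cst].
have an n : `|a n| < 1 by have /andP[? ?] := a01 n; rewrite gtr0_norm.
pose f n p := (weight b (fun w => blow_up T V z0 (a n) w * modulus (phi w)) (pt p))%:E.
have mf n : measurable_fun D (f n).
  apply/measurable_EFinP.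
  by apply: (@measurable_weight R b (fun w => blow_up T V z0 (a n) w * modulus (phi w)));
     exact: measurable_blow_up.
have f0 n p : D p -> (0 <= f n p)%E by rewrite lee_fin weight_ge0.
apply: (@le_trans _ _ (\int[mu2]_(p in D) limn_einf (f^~ p))%E); last first.
  have F := fatou mu2 (@measurable_planar_disk R) mf f0.
  apply: (le_trans F).
  by apply: limn_einf_le => n; exact: ft.
apply: ge0_le_integral_nomeas => p Dp; first by rewrite lee_fin weight_ge0.
have w1 : modulus (pt p) < 1 by apply/unit_disk_modulus.
set w := pt p in w1.
pose L := modulus (T.[z0] / V.[z0]) * (4 / (modulus (1 + w) ^+ 2 * modulus (1 - w) ^+ 2)).
have cf : f n p @[n --> \oo] --> (weight b (fun=> L * modulus (phi w)) w)%:E.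
  apply: cvg_EFin; first by apply: nearW.
  have cb := blow_up_cvg z01 Vz0 a01 acvg w1.
  have cg : blow_up T V z0 (a n) w * modulus (phi w) @[n --> \oo] --> L * modulus (phi w).
    by apply: cvgM => //; exact: cvg_cst.
  apply: cvgM; last exact: cvg_cst.
  by apply: cvgM; [apply: cvgM|exact: cvg_cst].
have -> : limn_einf (f^~ p) = (weight b (fun=> L * modulus (phi w)) w)%:E.
  rewrite is_cvg_limn_einfE; first exact: cvg_lim.
  by apply/cvg_ex; eexists; exact: cf.
rewrite lee_fin /weight ler_pM2r ?invr_gt0 ?pi_gt0//.
rewrite ler_wpM2r ?powR_ge0// modulusM ler_pXn2r ?nnegrE ?mulr_ge0 ?modulus_ge0//.
  rewrite ler_wpM2r ?modulus_ge0// schwarzian_koebe// modulusM modulusV.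
  rewrite (_ : 1 - w ^+ 2 = (1 + w) * (1 - w)); last by ring.
  rewrite !modulusM /modulus normcN -!/(modulus _).
  rewrite (_ : 6 = (6 : R)%:C); last by rewrite rmorph_nat.
  rewrite modulus_real ger0_norm// mulrACA -!expr2 /L [leRHS]mulrA ler_wpM2r//.
    by rewrite invr_ge0 mulr_ge0 ?sqr_ge0.
  (* Here [6 = 4 * (3 / 2)] meets the bound on the leading coefficient. *)
  lra.
by rewrite invr_ge0 mulr_ge0 ?sqr_ge0.
Qed.

End koebe_comparison.

(** * Quotients of norms in the extended reals *)

Section square_root.
Local Open Scope ereal_scope.
Context {R : realType}.

Lemma le_sqrte_sqr (x : \bar R) (t : R) : (0 <= t)%R -> 0 <= x ->
  (sqrte x <= t%:E) = (x <= (t ^+ 2)%:E).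
Proof.
case: x => [x| |] t0 x0 //=.
by rewrite !lee_fin -[X in (_ <= X)%R](ger0_norm t0) -sqrtr_sqr ler_sqrt ?sqr_ge0.
Qed.

(* The conclusion also holds for [N = 0] and [N = +oo], where [N^-1] is [+oo]
   and [0]. *)
Lemma sqrte_div_le (I : Type) (Y : I -> \bar R) (i0 : I) (X N M : \bar R) :
    0 <= N -> 0 <= X -> (forall i, 0 <= Y i) ->
    (forall t : R, (0 <= t)%R -> (forall i, Y i <= t%:E) -> X <= t%:E) ->
    (forall i, sqrte (Y i) / N <= M) ->
  sqrte X / N <= M.
Proof.
move=> N0 X0 Y0 XY YM.
have M0 : 0 <= M.
  by apply: le_trans (YM i0); rewrite mule_ge0 ?sqrte_ge0 ?inve_ge0.
case: M M0 YM => [m| |] // m0 YM; last by rewrite leey.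
case: N N0 YM => [r| |] // r0 YM; last by rewrite invey mule0.
(* For [N = 0] a finite [M] forces every [Y i] to vanish, and the bound [t = 0] then gives
   [X = 0]. *)
have [r00|r00] := eqVneq r 0%R.
  rewrite r00 in YM *; rewrite inve0 in YM *.
  have X00 : X = 0.
    apply/eqP; rewrite eq_le X0 andbT; apply: XY => // i.
    have := YM i; case: (leP (Y i) 0) => // Yi.
    have sY : 0 < sqrte (Y i).
      by case: (Y i) Yi => [y| |] //=; rewrite !lte_fin sqrtr_gt0.
    by rewrite gt0_muley.
  by rewrite X00 sqrte0 mul0e.
have rgt0 : (0 < r)%R by rewrite lt_neqAle eq_sym r00.
have rV : r%:E^-1 = (r^-1)%:E by rewrite inver (negbTE r00).
have mr0 : (0 <= m * r)%R by rewrite mulr_ge0.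
rewrite rV lee_pdivrMr// -EFinM le_sqrte_sqr//.
apply: XY; first exact: sqr_ge0.
move=> i; rewrite -le_sqrte_sqr//.
by rewrite EFinM -lee_pdivrMr// -rV.
Qed.

End square_root.

(** * Test functions transported to the critical point *)

Theorem theorem1p5 (R : realType) (alpha : R) (halpha : (-1 < alpha)%R)
    (f : R[i]%C -> R[i]%C) (hf : class_UR f)
    (hcrit : exists z0 : R[i]%C, unit_circle z0 /\ critical_point f z0) :
  (schwarzian_multiplier_norm (@koebe R) alpha <=
   schwarzian_multiplier_norm f alpha)%E.
Proof.
have [rf [af _ _ f'0]] := hf.
have [z0 [cz0 crit]] := hcrit.
have z01 : modulus z0 = 1.
  by apply/eqP; rewrite -(inj_eq (@complexI R)) -normC_modulus cz0.
have D0 : unit_disk (0 : R[i]) by rewrite /unit_disk/= normr0 ltr01.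
have [T [V [Vz0 c32 TV]]] := schwarzian_critical_point rf (af 0 D0) f'0 crit.
pose u := z0^-1; have z0n0 : z0 != 0.
  by apply/eqP => z00; move: z01; rewrite z00 /modulus ComplexField.Normc.normc0 => /esym/eqP; rewrite oner_eq0.
have u1 : modulus u = 1 by rewrite modulusV z01 invr1.
have b2 : alpha + 4 = alpha + (2 * 2)%:R by [].
have b0 : 0 < alpha + 4 + 1 by lra.
apply: ge_ereal_sup => _ [phi [[aphi nphi] [w0 Dw0 phiw0]] <-].
(* [psi a] transports [phi] by the inverse [z |-> tau a (u * z)] of [rho = z0 * tau (- a)]. Packing
   [a] with its bounds gives the index type of [sqrte_div_le]. *)
pose psi (a : {a : R | 0 < a < 1}) z := psi0 (sval a) alpha phi (u * z).
have abs1 (a : R) : 0 < a < 1 -> `|a| < 1 by move=> /andP[a0 a1]; rewrite gtr0_norm.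
have npsi a : bergman_normsq alpha (psi a) = bergman_normsq alpha phi.
  by case: a => a a01; exact: bergman_normsq_psi.
have normsq_ge0 b (g : R[i] -> R[i]) : 0 < b + 1 -> (0 <= bergman_normsq b g)%E.
  move=> b1; rewrite bergman_normsqE mule_ge0 ?lee_fin ?(ltW b1)//.
  by apply: integral_ge0 => p _; rewrite lee_fin weight_ge0.
have ahalf : (0 < (2^-1 : R)) && ((2^-1 : R) < 1) by apply/andP; split; lra.
apply: (@sqrte_div_le R _ (fun a => bergman_normsq (alpha + 4) (fun z => schwarzian f z * psi a z))
  (exist _ 2^-1 ahalf)).
- exact: sqrte_ge0.
- exact: normsq_ge0.
- by move=> a; exact: normsq_ge0.
- move=> t t0 Yt; rewrite bergman_normsqE.
  rewrite -lee_pdivlMl//; apply: (koebe_weight_le z01 Vz0 c32 aphi) => a a01.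
  rewrite lee_pdivlMl//; apply: le_trans (Yt (exist _ a a01)).
  rewrite bergman_normsqE lee_wpmul2l ?lee_fin ?(ltW b0)//.
  (* Undoing the automorphism and then the rotation turns the blow-up against [phi] into the double
     pole itself against [psi a], which [TV] compares with the Schwarzian of [f]. *)
  rewrite b2 -(@integral_weight_psi0 R a alpha 2 phi (fun v => pole_modulus T V z0 (z0 * v)) a01); last first.
    by apply: measurable_blow_up => //; exact: abs1.
  pose G v := pole_modulus T V z0 (z0 * v) * modulus (psi0 a alpha phi v).
  rewrite -(@integral_weight_rotation R _ G u u1); last first.
    apply: measurable_funM.
      have tau0 (w : R[i]) : tau 0 w = w by rewrite /tau rmorph0 mul0r !subr0 divr1.
      have := @measurable_pole R T V z0 0; rewrite normr0 ltr01 => /(_ isT).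
      by apply: eq_measurable_fun => p _; rewrite /= tau0.
    apply: (@measurable_modulus_analytic R (psi0 a alpha phi)).
    by apply: analytic_psi0 => //; exact: abs1.
  apply: ge0_le_integral_nomeas => p Dp; first by rewrite lee_fin weight_ge0.
  rewrite lee_fin /weight ler_pM2r ?invr_gt0 ?pi_gt0//.
  rewrite ler_wpM2r ?powR_ge0// /G mulrA mulfV// mul1r modulusM.
  rewrite ler_pXn2r ?nnegrE ?mulr_ge0 ?modulus_ge0// ler_wpM2r ?modulus_ge0//.
  exact: TV.
- move=> a; apply: ereal_sup_ubound; exists (psi a); last by rewrite /bergman_norm npsi.
  have a1 := abs1 _ (svalP a); have a1' : `|- sval a| < 1 by rewrite normrN.
  split.
    split; last by rewrite npsi.
    move=> z /unit_disk_modulus z1.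
    apply: (@derivable_comp1 _ (psi0 (sval a) alpha phi) (fun z => u * z)).
      by apply: derivable_mul1; [exact: derivable_cst|exact: derivable_id].
    apply: analytic_psi0 => //; apply/unit_disk_modulus.
    by rewrite modulusM u1 mul1r.
  have w1 : modulus w0 < 1 by apply/unit_disk_modulus.
  have t1 := tau_disk a1' w1.
  (* At [rho w0] the function [psi a] is [phi w0] times a nonzero power. *)
  exists (z0 * tau (- sval a) w0).
    by apply/unit_disk_modulus; rewrite modulusM z01 mul1r.
  rewrite /psi mulrA mulVf// mul1r.
  have p0 : 0 < modulus (psi0 (sval a) alpha phi (tau (- sval a) w0)) ^+ 2.
    rewrite modulus_psi0// -{1}(opprK (sval a)) tauK//.
    by rewrite mulr_gt0 ?exprn_gt0 ?modulus_gt0// powR_gt0// jac_gt0.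
  apply: contraTneq p0 => ->.
  by rewrite /modulus ComplexField.Normc.normc0 expr0n ltxx.
Qed.
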